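(* Let $0<t<u$ and let $g$ be a measurable function defined on $(0,+\infty)\times\mathbb R$ such that $\mathbf E[|g(\tau,\beta_u)|]<+\infty$. Then, $\mathbf P$-a.s., $$\mathbf E\left[g(\tau,\beta_u)\,|\,\mathcal F^P_t\right]=\mathbf E\left[g(\tau,\beta_u)\,|\,\beta_t\right]$$ $$=g(\tau,0)\,\mathbb I_{\{\tau\le t\}}+\int_{(t,u]}g(r,0)\,\phi_t(r,\beta_t)\,dF(r)\,\mathbb I_{\{t<\tau\}}$$ $$\qquad+\int_{(u,+\infty)}\int_{\mathbb R}g(r,y)\,p\left(\frac{r-u}{r-t}(u-t),\,y,\,\frac{r-u}{r-t}\beta_t\right)dy\;\phi_t(r,\beta_t)\,dF(r)\,\mathbb I_{\{t<\tau\}},$$ where $p(t,\cdot,y)$ is the Gaussian density with mean $y$ and variance $t$.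
   Context: Setting. $(\Omega,\mathcal F,\mathbf P)$ is a complete probability space and $\mathcal N_P$ is the collection of its $\mathbf P$-null sets. $W=(W_t)_{t\ge0}$ is a standard Brownian motion with continuous paths starting from $0$. $\tau:\Omega\to(0,\infty)$ is a strictly positive random variable with distribution function $F(t)=\mathbf P(\tau\le t)$. It is assumed throughout that $\tau$ and $W$ are independent and that $\tau$ is not a stopping time of the completed natural filtration of $W$ (so the case in which $\tau$ equals a positive constant is not considered). The information process is $\beta_t:=W_t-\frac{t}{\tau\vee t}W_{\tau\vee t}$, $t\ge0$, and $\mathcal F^P_t:=\sigma(\beta_s,\,0\le s\le t)\vee\mathcal N_P$. $\mathbb I_A$ denotes the indicator function of $A$. Let $p(t,x,y):=(2\pi t)^{-1/2}\exp(-(x-y)^2/(2t))$, $x\in\mathbb R$, be the Gaussian density with variance $t$ and mean $y$, and let $$\varphi_t(r,x):=\begin{cases}p\left(\frac{t(r-t)}{r},x,0\right),&0<t<r,\ x\in\mathbb R,\\ 0,& r\le t,\ x\in\mathbb R,\end{cases}\qquad \phi_t(r,x):=\frac{\varphi_t(r,x)}{\int_{(t,+\infty)}\varphi_t(v,x)\,dF(v)}.$$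
   Formalization: As printed, the equalities with E[g(τ,β_u)|β_t] fail on {τ≤t}, where β_t=0; they are proved a.s. on {t<τ}, and on all of Ω when g(τ,0) is a.s. constant on {τ≤t} (also necessary). E[g(τ,β_u)|F^P_t] = formula is proved in full. *)

(* Defs.v *)
From HB Require Import structures.
From mathcomp Require Import all_boot all_order all_algebra.
From mathcomp Require Import all_classical all_reals all_analysis.
From mathcomp Require Import measurable_realfun.

Set Implicit Arguments.
Unset Strict Implicit.
Unset Printing Implicit Defensive.

Import Order.TTheory GRing.Theory Num.Theory.
Import numFieldNormedType.Exports.

Local Open Scope classical_set_scope.
Local Open Scope ring_scope.

(** Sigma-algebras on the sample space are represented by their sets of events;
    processes are functions [R -> T -> R] of which only the values at times
    [0 <= t] are meaningful. *)

Section sigma_algebras.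
Context {d} {T : measurableType d} {R : realType} (P : probability T R).
Implicit Types (G H : set_system T) (X : R -> T -> R) (Y Z : T -> R).

Definition sigma_of Y : set_system T := preimage_set_system setT Y measurable.

Definition sigma_process (I : set R) X : set_system T :=
  <<s \bigcup_(s in I) sigma_of (X s) >>.

Definition completed_filtration X (t : R) : set_system T :=
  <<s sigma_process `[0, t] X `|` [set N | P.-negligible N] >>.

Definition indep G H : Prop :=
  forall A B, G A -> H B -> P (A `&` B) = (P A * P B)%E.

Definition is_stopping_time (Fil : R -> set_system T) Y : Prop :=
  forall t, 0 <= t -> Fil t [set w | Y w <= t].

(** [Z] is a version of the conditional expectation of [Y] given [G]. *)
Definition is_cond_exp G Y Z : Prop :=
  [/\ forall B, measurable B -> G (Z @^-1` B),
      P.-integrable setT (EFin \o Z) &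
      forall A, G A -> (\int[P]_(w in A) (Z w)%:E = \int[P]_(w in A) (Y w)%:E)%E].

Lemma cond_exp_exists G Y :
  sigma_algebra setT G -> G `<=` measurable ->
  P.-integrable setT (EFin \o Y) -> exists Z, is_cond_exp G Y Z.
Proof.
move=> sG GT iY; have mGE := sigma_algebra_id sG.
pose idG : T -> g_sigma_algebraType G := idfun.
have mid : measurable_fun setT idG.
  by move=> _ B; rewrite /measurable/= mGE => GB; rewrite setTI; exact: GT.
pose mm := isMeasurableFun.Build _ _ _ _ idG mid.
pose idM : {mfun T >-> g_sigma_algebraType G} := HB.pack idG mm.
pose Q : probability _ R := distribution P idM.
pose nu0 : {charge set T -> \bar R} := induced_charge iY.
pose nu1 : {charge set (g_sigma_algebraType G) -> \bar R} := pushforward nu0 idM.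
pose nu := nu1 mid.
have dom : nu `<< Q.
  apply: dominates_pushforward => //; apply/null_content_dominatesP => A mA PA.
  apply: null_set_integral => //; have mY := measurable_int P iY; exact: (@measurable_funS _ _ _ _ setT).
pose f := Radon_Nikodym nu Q.
have ffin x : f x \is a fin_num by exact: Radon_Nikodym_fin_num.
have fint : Q.-integrable setT f by exact: Radon_Nikodym_integrable.
have fE A (mA : measurable A) := Radon_Nikodym_integral dom mA.
have mf := measurable_int Q fint.
have fK : f = EFin \o (fine \o f) by apply/funext => w /=; rewrite fineK.
have intf : P.-integrable setT f.
  have mfT := measurableT_comp mf mid.
  apply/integrableP; split => //.
  have /integrableP[_] := fint; rewrite ge0_integral_pushforward//.
  exact: measurableT_comp.
exists (fine \o f); split.
- move=> B mB.
  have : measurable_fun (setT : set (g_sigma_algebraType G)) (fine \o f).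
    by apply/measurable_EFinP; rewrite -fK.
  by move=> /(_ measurableT B mB); rewrite setTI /measurable/= mGE.
- by rewrite -fK.
- move=> A GA.
  have mA : measurable (A : set (g_sigma_algebraType G)) by rewrite /measurable/= mGE.
  transitivity (\int[P]_(w in A) f w)%E; first by apply: eq_integral => w _ /=; rewrite fineK.
  have := fE A mA; rewrite {1}/nu/nu1/= /pushforward /= => /esym.
  rewrite integral_pushforward//.
  by apply: (integrableS measurableT) => //; exact: GT.
Qed.

Record standard_brownian_motion (W : R -> T -> R) : Prop := {
  bm_measurable : forall t, 0 <= t -> measurable_fun setT (W t) ;
  bm_start : forall w, W 0 w = 0 ;
  bm_continuous : forall w, {within `[0, +oo[, continuous (W ^~ w)} ;
  bm_indep_increments : forall s t, 0 <= s -> s < t ->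
    indep (sigma_process `[0, s] W) (sigma_of (W t \- W s)) ;
  bm_gaussian_increments : forall s t, 0 <= s -> s < t ->
    forall B : set R, measurable B ->
      P ((W t \- W s) @^-1` B) = normal_prob 0 (Num.sqrt (t - s)) B }.

End sigma_algebras.

Section distribution_function.
Context {d} {T : measurableType d} {R : realType} (P : probability T R).
Variable tau : {RV P >-> R}.

Definition distrib_fun (t : R) : R := fine (cdf tau t).

Let distrib_fun_nd : nondecreasing distrib_fun.
Proof.
move=> x y xy; rewrite /distrib_fun fine_le ?fin_num_measure//.
exact: cdf_nondecreasing.
Qed.

Let distrib_fun_rc : right_continuous distrib_fun.
Proof.
move=> a; apply: fine_cvg.
by rewrite fineK ?fin_num_measure//; exact: cdf_right_continuous.
Qed.

HB.instance Definition _ :=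
  isCumulative.Build R _ R distrib_fun distrib_fun_nd distrib_fun_rc.

Definition dF : {measure set (measurableTypeR R) -> \bar R} :=
  lebesgue_stieltjes_measure distrib_fun.

End distribution_function.

Section information_process.
Context {d} {T : measurableType d} {R : realType}.

Definition information_process (W : R -> T -> R) (tau : T -> R) (t : R) (w : T) : R :=
  W t w - t / Num.max (tau w) t * W (Num.max (tau w) t) w.

(** Gaussian density at [x] with variance [t] and mean [y]. *)
Definition gauss (t x y : R) : R :=
  (Num.sqrt (2 * pi * t))^-1 * expR (- (x - y) ^+ 2 / (2 * t)).

Lemma gaussE (t x y : R) : 0 < t -> gauss t x y = normal_pdf y (Num.sqrt t) x.
Proof.
move=> t0; rewrite normal_pdfE ?gt_eqF ?sqrtr_gt0// /gauss /normal_peak /normal_fun.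
rewrite sqr_sqrtr ?ltW//; congr ((Num.sqrt _)^-1 * expR (_ / _)).
  by rewrite mulr_natl mulrnAl [pi * t]mulrC.
by rewrite mulr_natl.
Qed.

(** The density of [beta_t] given [tau = r], cut off at [r <= t]. *)
Definition varphi (t r x : R) : R :=
  if 0 < t < r then gauss (t * (r - t) / r) x 0 else 0.

Variables (P : probability T R) (tau : {RV P >-> R}).

Definition phi (t r x : R) : R :=
  varphi t r x / \int[dF tau]_(v in `]t, +oo[) varphi t v x.

Definition prediction (beta : R -> T -> R) (g : R * R -> R) (t u : R) (w : T) : R :=
  g (tau w, 0) * \1_[set w | tau w <= t] w
  + (\int[dF tau]_(r in `]t, u]) (g (r, 0) * phi t r (beta t w)))
    * \1_[set w | t < tau w] w
  + (\int[dF tau]_(r in `]u, +oo[)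
      ((\int[lebesgue_measure]_y
          (g (r, y) * gauss ((r - u) / (r - t) * (u - t)) y
                            ((r - u) / (r - t) * beta t w)))
       * phi t r (beta t w)))
    * \1_[set w | t < tau w] w.

End information_process.

(** [beta_t] vanishes on [{tau <= t}], so that [E[g(tau, beta_u) | beta_t]] is
    constant on this event, whereas [prediction] equals [g(tau, 0)] there: the two
    can agree almost surely only if [g(tau, 0)] is constant on [{tau <= t}]. *)
Lemma cond_exp_info_prediction d (T : measurableType d) (R : realType)
    (P : probability T R) (W : R -> T -> R) (tau : {RV P >-> R}) (t u : R)
    (ht : 0 < t) (g : R * R -> R) X (Z2 : T -> R) :
  let beta := information_process W tau in
  is_cond_exp P (sigma_of (beta t)) X Z2 ->
  {ae P, forall w, Z2 w = prediction tau beta g t u w} ->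
  exists c, {ae P, forall w, tau w <= t -> g (tau w, 0) = c}.
Proof.
move=> beta [mZ _ _] hZ.
have b0 w : tau w <= t -> beta t w = 0.
  by move=> h; rewrite /beta /information_process max_r// divff ?gt_eqF// mul1r subrr.
have cst w w' : tau w <= t -> tau w' <= t -> Z2 w = Z2 w'.
  move=> h h'; have [B mB eB] := mZ [set Z2 w] (measurable_set1 _).
  have : (setT `&` beta t @^-1` B) w by rewrite eB.
  case=> _ /=; rewrite b0// => B0.
  have : (Z2 @^-1` [set Z2 w]) w' by rewrite -eB; split => //=; rewrite b0.
  by move=> /= ->.
have [[w0 hw0]|no] := pselect (exists w, tau w <= t); last first.
  by exists 0; apply: aeW => w hw; exfalso; apply: no; exists w.
exists (Z2 w0); apply: filterS hZ => w /= hZ hw.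
rewrite (cst w0 w)// hZ /prediction !indicE mem_set//= mulr1.
by rewrite memNset/= ?mulr0 ?addr0// => /lt_geF; rewrite hw.
Qed.

(* Main.v *)
Require Import Defs.
From HB Require Import structures.
From mathcomp Require Import all_boot all_order all_algebra.
From mathcomp Require Import all_classical all_reals all_analysis.
From mathcomp Require Import measurable_realfun ring.

(** Given [tau = r], the information process is the Brownian bridge
    [W s - s / r W r] of length [r] up to time [r], and it stays at [0] afterwards.
    The theorem is the Markov property of the randomised bridge together with Bayes'
    formula for its random length.

    On [{tau <= t}] the value [g (tau, 0)] is known at time [t]: since a bridge of
    length [r] does not vanish at a fixed time [s < r] almost surely
    ([survival_beta_neq0]), the events [{tau <= s}] and [{beta s = 0}] agree up to null
    sets, so that [tau] is a stopping time of the completed filtration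
    ([completed_tau_le]). The sigma-algebra of [beta t] alone only knows the event
    [{tau <= t}], which is why the constancy of [g (tau, 0)] enters the last claim.

    On [{t < tau}] the key identity is
      [beta s = (W s - s / t W t) + s / t beta t], for [s <= t]:
    the past of [beta] is made of [beta t] and of the bridge of length [t], whose
    definition does not involve [tau]. This bridge is independent of [W t]
    ([indep_bridge]), of the later increments of [W] and of [tau], hence of the triple
    [(tau, beta t, beta u)]; so it does not help to predict [g (tau, beta u)].
    Independence comes from one elementary fact, applied three times: for independent
    centred Gaussians [x] and [y] of variances [a] and [b], the residual
    [x - a / (a + b) (x + y)] is independent of [x + y] ([integral_gaussian_rotation],
    [gauss_pair_rotation]). It yields the independence of the bridge of length [t] from
    its endpoint (by induction on the number of times), the law of the bridge of length
    [r] at time [t] ([law_bridge_mid]) and, for [t < u < r], the decomposition of its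
    value at [u] into [(r - u) / (r - t)] times its value at [t] and an independent
    Gaussian of variance [(r - u) / (r - t) (u - t)] ([law_bridge_innov]).

    As [tau] is independent of [W], one may integrate over the length
    ([ge0_integral_mix], which rests on the joint measurability of continuous
    processes). This gives [integral_joint_mean]: for [g >= 0] and [k >= 0] and an event
    [C] of the bridge of length [t], the integral of [k (beta t) g (tau, beta u)] over
    [C] and [{t < tau}] is [P C] times a Lebesgue integral of [k] times [joint_mean].
    With [g = 1] one reads off the density of [beta t] on [{t < tau}], and the quotient
    of the two is the conditional mean ([integral_predictor]). A monotone class
    argument extends it from such events to all events known at time [t]
    ([completed_cylinder], [integral_predictor_past]). A general [g] is split
    into positive and negative parts, and [prediction_afterE] recognises
    the iterated integrals of the statement. *)

Import Order.TTheory GRing.Theory Num.Theory.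
Import numFieldNormedType.Exports.

Local Open Scope classical_set_scope.
Local Open Scope ring_scope.

(** * Densities and joint laws *)

Section density.
Context {d} {T : measurableType d} {R : realType}.
Local Open Scope ereal_scope.
Import HBNNSimple.

(** Both sides agree on indicators by hypothesis, hence on simple functions, and
    monotone convergence carries the identity to all nonnegative [f]. *)
Lemma ge0_integral_density (mu nu : {measure set T -> \bar R}) (p : T -> R)
    (f : T -> \bar R) :
  measurable_fun setT p -> (forall x, (0 <= p x)%R) ->
  (forall A, measurable A -> nu A = \int[mu]_(x in A) (p x)%:E) ->
  measurable_fun setT f -> (forall x, 0 <= f x) ->
  \int[nu]_x f x = \int[mu]_x (f x * (p x)%:E).
Proof.
move=> mp p0 nuE mf f0.
have mpE : measurable_fun setT (EFin \o p) by exact/measurable_EFinP.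
pose h := nnsfun_approx measurableT mf.
have h0 n x : 0 <= (h n x)%:E by rewrite lee_fin.
have nd x : {homo (fun n => (h n x)%:E) : n m / (n <= m)%N >-> n <= m}.
  by move=> n m nm; rewrite lee_fin; exact/lefP/nd_nnsfun_approx.
have hf x : (h n x)%:E @[n --> \oo] --> f x by exact: cvg_nnsfun_approx.
transitivity (limn (fun n => \int[nu]_x (h n x)%:E)).
  rewrite -monotone_convergence//.
  - by apply: eq_integral => x _; apply/esym/cvg_lim => //; exact: hf.
  - by move=> n; exact/measurable_EFinP.
transitivity (limn (fun n => \int[mu]_x ((h n x)%:E * (p x)%:E))); last first.
  rewrite -monotone_convergence//.
  - apply: eq_integral => x _; apply/cvg_lim => //.
    by apply: cvgeZr => //; exact: hf.
  - by move=> n; apply: emeasurable_funM => //; exact/measurable_EFinP.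
  - by move=> n x _; rewrite mule_ge0// lee_fin.
  - by move=> x _ n m nm; rewrite lee_wpmul2r ?lee_fin//; exact: nd.
congr (limn _); apply/funext => n.
under eq_integral do rewrite fimfunE -fsumEFin//.
under [RHS]eq_integral => x _.
  rewrite fimfunE -fsumEFin// ge0_mule_fsuml; last first.
    by move=> r; rewrite nnfun_muleindic_ge0.
  over.
rewrite !ge0_integral_fsum//.
- apply: eq_fsbigr => r _.
  rewrite integralZl_indic_nnsfun// integral_indic// setIT nuE//.
  under [RHS]eq_integral do rewrite EFinM -muleA.
  have [r0|r0] := leP 0%R r; last first.
    rewrite preimage_nnfun0// integral_set0 mule0 integral0_eq// => x _.
    by rewrite indic0 mul0e mule0.
  rewrite ge0_integralZl//; last 2 first.
  - by apply: emeasurable_funM => //; exact/measurable_EFinP.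
  - by move=> x _; rewrite mule_ge0// lee_fin.
  congr (_ * _); rewrite [LHS]integral_mkcond; apply: eq_integral => x _.
  by rewrite patchE indicE; case: (x \in _); rewrite ?mul1e ?mul0e.
- move=> r; apply: emeasurable_funM => //; apply/measurable_EFinP.
  exact: measurable_funM.
- by move=> r x _; rewrite mule_ge0 ?nnfun_muleindic_ge0// lee_fin.
- by move=> r; apply/measurable_EFinP; exact: measurable_funM.
- by move=> r x _; rewrite nnfun_muleindic_ge0.
Qed.
End density.

Section pair_law.
Context {d} {T : measurableType d} {R : realType} (P : {measure set T -> \bar R}).
Local Open Scope ereal_scope.

(** The law of [(X, Y)] on the event [C] is a product measure, because it is one
    on rectangles; Tonelli does the rest. The event [C] is carried along so that
    independence from a whole sigma-algebra can be handled event by event. *)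
Lemma ge0_integral_pair_law {d1 d2} {T1 : measurableType d1} {T2 : measurableType d2}
    (m1 : {sigma_finite_measure set T1 -> \bar R})
    (m2 : {sigma_finite_measure set T2 -> \bar R})
    (C : set T) (X : T -> T1) (Y : T -> T2) (f : T1 * T2 -> \bar R) :
  measurable C -> measurable_fun setT X -> measurable_fun setT Y ->
  (forall A B, measurable A -> measurable B ->
    P (C `&` (X @^-1` A `&` Y @^-1` B)) = m1 A * m2 B) ->
  measurable_fun setT f -> (forall z, 0 <= f z) ->
  \int[P]_(w in C) f (X w, Y w) = \int[m1]_x \int[m2]_y f (x, y).
Proof.
move=> mC mX mY XYE mf f0.
pose XY w := (X w, Y w).
have mXY : measurable_fun setT XY by exact: measurable_fun_pair.
pose PC : {measure set T -> \bar R} := mrestr P mC.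
pose nu0 : {measure set (T1 * T2) -> \bar R} := pushforward PC XY.
pose nu := nu0 mXY.
have mfXY : measurable_fun setT (f \o XY) by exact: measurableT_comp.
transitivity (\int[nu]_z f z).
  rewrite [RHS]ge0_integral_pushforward//= ?preimage_setT.
  rewrite (@ge0_integral_density _ _ _ P PC (\1_C))//.
  - rewrite integral_mkcond; apply: eq_integral => w _.
    by rewrite patchE indicE; case: (w \in C); rewrite ?mule1 ?mule0.
  - by move=> A mA; rewrite integral_indic//= /PC /mrestr setIC.
transitivity (\int[m1 \x m2]_z f z); last by rewrite fubini_tonelli1.
apply: eq_measure_integral => A mA _; apply/esym/product_measure_unique => // A1 A2 mA1 mA2.
by rewrite /nu /nu0 /pushforward/= /PC /mrestr -XYE// setIC.
Qed.
End pair_law.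

(** ** Gaussian calculus *)

Section gaussian.
Context {R : realType}.
Local Open Scope ereal_scope.

Lemma ge0_integral_shift (c : R) (f : R -> \bar R) :
  measurable_fun setT f -> (forall x, 0 <= f x) ->
  \int[lebesgue_measure]_x f (x + c)%R = \int[lebesgue_measure]_x f x.
Proof.
move=> mf f0.
pose S : R -> measurableTypeR R := fun x => (x + c)%R.
have mS : measurable_fun setT S by exact: measurable_funD.
pose nu0 : {measure set (measurableTypeR R) -> \bar R} :=
  pushforward lebesgue_measure S.
pose nu := nu0 mS.
transitivity (\int[nu]_x f x).
  by rewrite ge0_integral_pushforward.
apply: eq_measure_integral => A mA _; apply/esym/lebesgue_measure_unique => // _ [[a b]] _ <-.
rewrite /nu /nu0 /pushforward/=.
rewrite [RHS](_ : _ = lebesgue_measure `](a - c)%R, (b - c)%R]%classic); last first.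
  congr (lebesgue_measure _).
  by apply/seteqP; split => x /=; rewrite /S !in_itv/= ltrBlDr lerBrDr.
by rewrite !lebesgue_measure_itv/= !lte_fin ltrD2r; case: ifPn => // _; rewrite -!EFinB; congr EFin; ring.
Qed.

Lemma gauss_ge0 (a x y : R) : (0 <= gauss a x y)%R.
Proof. by rewrite /gauss mulr_ge0 ?expR_ge0 ?invr_ge0. Qed.

Lemma ge0_integral_gauss (a : R) (f : R -> \bar R) : (0 < a)%R ->
  measurable_fun setT f -> (forall x, 0 <= f x) ->
  \int[normal_prob 0 (Num.sqrt a)]_x f x =
  \int[lebesgue_measure]_x (f x * (gauss a x 0)%:E).
Proof.
move=> a0 mf f0.
rewrite (@ge0_integral_density _ _ _ lebesgue_measure _ (normal_pdf 0 (Num.sqrt a)))//.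
- by apply: eq_integral => x _; rewrite gaussE.
- exact: measurable_normal_pdf.
- by move=> x; exact: normal_pdf_ge0.
Qed.

Lemma measurable_fun_inv {d} {T : measurableType d} (f : T -> R) :
  measurable_fun setT f -> measurable_fun setT (fun x => (f x)^-1)%R.
Proof.
move=> mf; apply: (measurableT_comp _ mf).
rewrite -(setvU [set 0%R]); apply/measurable_funU => //; first exact: measurableC.
split; last by apply: measurable_fun_set1.
apply: open_continuous_measurable_fun; first exact: closed_openC.
by move=> x; rewrite inE => /= /eqP x0; exact: inv_continuous.
Qed.

Lemma measurable_fun_gauss {d} {T : measurableType d} (v x m : T -> R) :
  measurable_fun setT v -> measurable_fun setT x -> measurable_fun setT m ->
  measurable_fun setT (fun w => gauss (v w) (x w) (m w)).
Proof.
move=> mv mx mm; rewrite /gauss; apply: measurable_funM.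
  apply: measurable_fun_inv; apply: measurableT_comp.
    by apply: continuous_measurable_fun; exact: sqrt_continuous.
  exact: measurable_funM.
apply: measurableT_comp => //; apply: measurable_funM; last first.
  by apply: measurable_fun_inv; exact: measurable_funM.
apply: measurableT_comp => //; apply: (measurable_funX 2).
exact: measurable_funB.
Qed.

(** With [l = a / (a + b)] the cross term [2 z s (l / a - (1 - l) / b)] of the
    exponent vanishes, which is exactly why [x - l (x + y)] is uncorrelated with
    [x + y]. *)
Lemma gauss_rotation (a b z s : R) : (0 < a)%R -> (0 < b)%R ->
  (gauss a (z + a / (a + b) * s) 0 * gauss b (s - (z + a / (a + b) * s)) 0 =
   gauss (a * b / (a + b)) z 0 * gauss (a + b) s 0)%R.
Proof.
move=> a0 b0; have ab0 : (0 < a + b)%R by rewrite addr_gt0.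
rewrite /gauss mulrACA -expRD [RHS]mulrACA -expRD; congr (_ * expR _)%R.
  rewrite -!invfM -!sqrtrM ?mulr_ge0 ?pi_ge0 ?divr_ge0 ?mulr_ge0 ?ltW//.
  by congr ((Num.sqrt _)^-1)%R; field; rewrite gt_eqF.
  by rewrite invr_gt0.
by field; rewrite !gt_eqF.
Qed.

Lemma ge0_integral_gauss2 (a b : R) (f : R * R -> \bar R) : (0 < a)%R -> (0 < b)%R ->
  measurable_fun setT f -> (forall x, 0 <= f x) ->
  \int[normal_prob 0 (Num.sqrt a)]_x \int[normal_prob 0 (Num.sqrt b)]_y f (x, y) =
  \int[lebesgue_measure]_x \int[lebesgue_measure]_y
    (f (x, y) * (gauss a x 0 * gauss b y 0)%:E).
Proof.
move=> a0 b0 mf f0.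
rewrite ge0_integral_gauss//; last 2 first.
- exact: (measurable_fun_fubini_tonelli_F (m2 := normal_prob 0 (Num.sqrt b))).
- by move=> x; exact: integral_ge0.
apply: eq_integral => x _.
have mfx : measurable_fun setT (fun y => f (x, y)).
  by apply: measurableT_comp => //; exact: measurable_pair1.
have mg : measurable_fun setT (fun y => gauss b y 0).
  exact: measurable_fun_gauss.
rewrite ge0_integral_gauss// -ge0_integralZr//; last 3 first.
- by apply: emeasurable_funM => //; exact/measurable_EFinP.
- by move=> y _; rewrite mule_ge0// lee_fin gauss_ge0.
- by rewrite lee_fin gauss_ge0.
by apply: eq_integral => y _; rewrite -muleA -EFinM [in RHS]mulrC.
Qed.

(** If [x] and [y] are independent centred Gaussians of variances [a] and [b], then
    [x + y] is independent of the residual [x - a / (a + b) (x + y)]. This is the only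
    Gaussian fact used below: two shears, which preserve Lebesgue measure, turn one
    product density into the other. *)
Lemma integral_gaussian_rotation (a b : R) (F : R * R -> \bar R) : (0 < a)%R -> (0 < b)%R ->
  measurable_fun setT F -> (forall x, 0 <= F x) ->
  \int[normal_prob 0 (Num.sqrt a)]_x \int[normal_prob 0 (Num.sqrt b)]_y
     F (x - a / (a + b) * (x + y), x + y)%R =
  \int[normal_prob 0 (Num.sqrt (a * b / (a + b)))]_z
    \int[normal_prob 0 (Num.sqrt (a + b))]_s F (z, s).
Proof.
move=> a0 b0 mF F0; have ab0 : (0 < a + b)%R by rewrite addr_gt0.
set l := (a / (a + b))%R.
have mF1 : measurable_fun setT (fun z : R * R => F (z.1 - l * (z.1 + z.2), z.1 + z.2)%R).
  apply: measurableT_comp => //; apply: measurable_fun_pair; last exact: measurable_funD.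
  by apply: measurable_funB => //; apply: measurable_funM => //; exact: measurable_funD.
have c0 : (0 < a * b / (a + b))%R by rewrite divr_gt0// mulr_gt0.
have E1 := ge0_integral_gauss2 a b _ a0 b0 mF1 (fun z => F0 _).
have E2 := ge0_integral_gauss2 _ _ F c0 ab0 mF F0.
etransitivity; first exact: E1.
symmetry; etransitivity; first exact: E2.
symmetry => /= {E1 E2}.
(* for fixed x, translate the inner variable: (x, y) becomes (x, s = x + y) *)
transitivity (\int[lebesgue_measure]_x \int[lebesgue_measure]_s
    (F (x - l * s, s)%R * (gauss a x 0 * gauss b (s - x) 0)%:E)).
  apply: eq_integral => x _.
  rewrite -[RHS](ge0_integral_shift x).
  - by apply: eq_integral => y _; rewrite addrK [(x + y)%R]addrC.
  - apply: emeasurable_funM.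
      apply: measurableT_comp => //; apply: measurable_fun_pair => //.
      by apply: measurable_funB => //; exact: measurable_funM.
    apply/measurable_EFinP; apply: measurable_funM => //.
    by apply: measurable_fun_gauss => //; exact: measurable_funB.
  - by move=> y; rewrite mule_ge0// lee_fin mulr_ge0// gauss_ge0.
pose H1 (z : R * R) := F (z.1 - l * z.2, z.2)%R *
  (gauss a z.1 0 * gauss b (z.2 - z.1) 0)%:E.
pose H2 (z : R * R) := F z *
  (gauss (a * b / (a + b)) z.1 0 * gauss (a + b) z.2 0)%:E.
have mH1 : measurable_fun setT H1.
  apply: emeasurable_funM.
    apply: measurableT_comp => //; apply: measurable_fun_pair => //.
    by apply: measurable_funB => //; exact: measurable_funM.
  apply/measurable_EFinP; apply: measurable_funM; apply: measurable_fun_gauss => //.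
  exact: measurable_funB.
have mH2 : measurable_fun setT H2.
  apply: emeasurable_funM => //; apply/measurable_EFinP.
  by apply: measurable_funM; exact: measurable_fun_gauss.
have H10 z : 0 <= H1 z by rewrite mule_ge0// lee_fin mulr_ge0// gauss_ge0.
have H20 z : 0 <= H2 z by rewrite mule_ge0// lee_fin mulr_ge0// gauss_ge0.
etransitivity.
  exact: (fubini_tonelli (m1 := lebesgue_measure) (m2 := lebesgue_measure) H1 mH1 H10).
symmetry; etransitivity.
  exact: (fubini_tonelli (m1 := lebesgue_measure) (m2 := lebesgue_measure) H2 mH2 H20).
symmetry.
apply: eq_integral => s _.
(* for fixed s, translate the other variable: (x, s) becomes (z = x - l s, s) *)
have mH1s : measurable_fun setT (fun x => H1 (x, s)) by exact: measurable_fun_pair1.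
etransitivity; first exact/esym/(ge0_integral_shift (l * s)%R _ mH1s).
by apply: eq_integral => z _; rewrite /H1/= addrK gauss_rotation.
Qed.
End gaussian.

(** * Monotone classes and independence *)

Section pi_lambda.
Context {d} {T : measurableType d} {R : realType} (mu : {measure set T -> \bar R}).
Local Open Scope ereal_scope.

(** Dynkin's argument: for integrable [f] and [g], the measurable sets over which
    the integrals agree form a Dynkin system. *)
Lemma eq_integral_g_sigma_algebra (G : set_system T) (f g : T -> \bar R) :
  setI_closed G -> G `<=` measurable ->
  mu.-integrable setT f -> mu.-integrable setT g ->
  \int[mu]_w f w = \int[mu]_w g w ->
  (forall A, G A -> \int[mu]_(w in A) f w = \int[mu]_(w in A) g w) ->
  forall A, <<s G >> A -> \int[mu]_(w in A) f w = \int[mu]_(w in A) g w.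
Proof.
move=> GI Gm fi gi fgT fgG A.
rewrite -(setI_closed_g_dynkin_g_sigma_algebra GI).
pose D := [set A | measurable A /\ \int[mu]_(w in A) f w = \int[mu]_(w in A) g w].
suff : <<d G >> `<=` D by move=> /[apply] -[].
apply: smallest_sub; last by move=> B GB; split; [exact: Gm|exact: fgG].
split.
- by split.
- move=> B [mB eB]; have mBC : measurable (~` B) by exact: measurableC.
  have spl h : mu.-integrable setT h ->
      \int[mu]_(w in ~` B) h w = \int[mu]_w h w - \int[mu]_(w in B) h w.
    move=> hi; rewrite -(setUv B) integral_setU//; last 2 first.
    - by rewrite setUv; exact: measurable_int hi.
    - by apply/disj_setPS; rewrite setICr.
    rewrite addeAC subee ?add0e//.
    by apply: integrable_fin_num => //; exact: integrableS hi.
  by split => //; rewrite !spl// fgT eB.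
- move=> F tF DF; have mF n : measurable (F n) by have [] := DF n.
  split; first exact: bigcupT_measurable.
  rewrite !integral_bigcup//; last 2 first.
  - by apply: integrableS gi => //; exact: bigcupT_measurable.
  - by apply: integrableS fi => //; exact: bigcupT_measurable.
  by apply: eq_eseriesr => n _; have [] := DF n.
Qed.

End pi_lambda.

Section indep.
Context {d} {T : measurableType d} {R : realType} (P : probability T R).
Local Open Scope ereal_scope.

Lemma indep_g_sigma_algebra (G H : set_system T) :
  setI_closed G -> G `<=` measurable -> H `<=` measurable ->
  indep P G H -> indep P <<s G >> H.
Proof.
move=> GI Gm Hm GH A B sA HB.
have mB := Hm _ HB.
have mA : measurable A by apply: (smallest_sub _ Gm sA); exact: sigma_algebra_measurable.
have iE C : measurable C -> \int[P]_(w in C) (\1_B w)%:E = P (C `&` B).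
  by move=> mC; rewrite integral_indic// setIC.
have cE C : measurable C -> \int[P]_(w in C) (cst (P B) w) = P C * P B.
  move=> mC; have PBf : P B \is a fin_num by rewrite fin_num_measure.
  by rewrite -(fineK PBf) integral_cst// muleC.
rewrite -iE// -cE//; apply: (@eq_integral_g_sigma_algebra _ _ _ P G) => //.
- by apply: integrable_indic.
- have PBf : P B \is a fin_num by rewrite fin_num_measure.
  by rewrite -(fineK PBf); exact: finite_measure_integrable_cst.
- by rewrite iE// cE// setTI probability_setT mul1e.
- by move=> C GC; rewrite iE ?cE; [exact: GH|exact: Gm|exact: Gm].
Qed.

Lemma indepS (G G' H H' : set_system T) : G' `<=` G -> H' `<=` H ->
  indep P G H -> indep P G' H'.
Proof. by move=> sG sH GH A B /sG GA /sH HB; exact: GH. Qed.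

Definition gauss_law (C : set T) (X : T -> R) (a : R) :=
  forall A, measurable A -> P (C `&` X @^-1` A) = P C * normal_prob 0 (Num.sqrt a) A.

(** For [C = setT] this says that [X] and [Y] are independent centred Gaussians of
    variances [a] and [b]. If it holds for all [C] in a sigma-algebra, then the pair
    is moreover independent of that sigma-algebra. *)
Definition gauss_pair_law (C : set T) (X : T -> R) (a : R) (Y : T -> R) (b : R) :=
  forall A B, measurable A -> measurable B ->
    P (C `&` (X @^-1` A `&` Y @^-1` B)) =
    P C * (normal_prob 0 (Num.sqrt a) A * normal_prob 0 (Num.sqrt b) B).

Lemma ge0_integral_gauss_pair C X a Y b (f : R * R -> \bar R) :
  measurable C -> measurable_fun setT X -> measurable_fun setT Y ->
  gauss_pair_law C X a Y b ->
  measurable_fun setT f -> (forall z, 0 <= f z) ->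
  \int[P]_(w in C) f (X w, Y w) = P C *
   \int[normal_prob 0 (Num.sqrt a)]_x \int[normal_prob 0 (Num.sqrt b)]_y f (x, y).
Proof.
move=> mC mX mY XY mf f0.
have PCf : P C \is a fin_num by rewrite fin_num_measure.
pose c : {nonneg R} := NngNum (fine_ge0 (measure_ge0 P C)).
pose m1 : {finite_measure set (measurableTypeR R) -> \bar R} :=
  mscale c (normal_prob 0 (Num.sqrt a)).
have XYE A B : measurable A -> measurable B ->
    P (C `&` (X @^-1` A `&` Y @^-1` B)) = m1 A * normal_prob 0 (Num.sqrt b) B.
  by move=> mA mB; rewrite XY// /m1/= /mscale/= fineK// muleA.
etransitivity.
  exact: (ge0_integral_pair_law P m1 (normal_prob 0 (Num.sqrt b)) C X Y f).
pose h x := \int[normal_prob 0 (Num.sqrt b)]_y f (x, y).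
have mh : measurable_fun setT h.
  exact: (measurable_fun_fubini_tonelli_F (m2 := normal_prob 0 (Num.sqrt b))).
have h0 x : setT x -> 0 <= h x by move=> _; exact: integral_ge0.
rewrite -(fineK PCf).
exact: (ge0_integral_mscale (normal_prob 0 (Num.sqrt a)) measurableT c mh h0).
Qed.

Lemma gauss_pair_rotation C X a Y b : (0 < a)%R -> (0 < b)%R ->
  measurable C -> measurable_fun setT X -> measurable_fun setT Y ->
  gauss_pair_law C X a Y b ->
  gauss_pair_law C (fun w => X w - a / (a + b) * (X w + Y w))%R (a * b / (a + b))
    (X \+ Y)%R (a + b).
Proof.
move=> a0 b0 mC mX mY XY A B mA mB.
pose l := (a / (a + b))%R.
pose F (z : R * R) : \bar R := (\1_A z.1 * \1_B z.2)%:E.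
have mF : measurable_fun setT F.
  apply/measurable_EFinP; apply: measurable_funM.
    exact: (measurableT_comp (measurable_indic mA)).
  exact: (measurableT_comp (measurable_indic mB)).
have F0 z : 0 <= F z by rewrite lee_fin mulr_ge0.
have mXY : measurable_fun setT (X \+ Y)%R by exact: measurable_funD.
have mXl : measurable_fun setT (fun w => X w - a / (a + b) * (X w + Y w))%R.
  by apply: measurable_funB => //; exact: measurable_funM.
have XYi (X' Y' : T -> R) w :
    F (X' w, Y' w) = (\1_(X' @^-1` A `&` Y' @^-1` B) w)%:E.
  by rewrite /F indicI.
have mpre (X' Y' : T -> R) : measurable_fun setT X' -> measurable_fun setT Y' ->
    measurable (X' @^-1` A `&` Y' @^-1` B).
  by move=> mX' mY'; apply: measurableI; rewrite -[_ @^-1` _]setTI; [exact: mX'|exact: mY'].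
transitivity (\int[P]_(w in C) F (X w - l * (X w + Y w), X w + Y w)%R).
  under eq_integral do rewrite (XYi (fun w => X w - l * (X w + Y w))%R (X \+ Y)%R).
  by rewrite integral_indic//; [rewrite setIC|exact: mpre].
pose F1 (z : R * R) := F (z.1 - l * (z.1 + z.2), z.1 + z.2)%R.
have mF1 : measurable_fun setT F1.
  apply: measurableT_comp => //; apply: measurable_fun_pair; last exact: measurable_funD.
  by apply: measurable_funB => //; apply: measurable_funM => //; exact: measurable_funD.
etransitivity.
  exact: (ge0_integral_gauss_pair C X a Y b F1 mC mX mY XY mF1 (fun z => F0 _)).
congr (_ * _); etransitivity.
  exact: (integral_gaussian_rotation a b F a0 b0 mF F0).
rewrite /F/=; under eq_integral => x _.
  under eq_integral do rewrite EFinM.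
  rewrite ge0_integralZl//; last first.
    by apply/measurable_EFinP; exact: measurable_indic.
  rewrite integral_indic// setIT.
  over.
rewrite ge0_integralZr//; last by apply/measurable_EFinP; exact: measurable_indic.
by rewrite integral_indic// setIT.
Qed.

End indep.

(** * The bridges of a Brownian motion *)

Section generated.
Context {d} {T : measurableType d} {R : realType}.
Implicit Types (X : R -> T -> R) (Y Z : T -> R) (G : set_system T).

Lemma sigma_process_sub (I : set R) X G :
  sigma_algebra setT G -> (forall s, I s -> sigma_of (X s) `<=` G) ->
  sigma_process I X `<=` G.
Proof.
move=> sG XG; apply: smallest_sub => // A [s Is]; exact: XG.
Qed.

Lemma sigma_of_process (I : set R) X s : I s -> sigma_of (X s) `<=` sigma_process I X.
Proof. by move=> Is A XA; apply: sub_sigma_algebra; exists s. Qed.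

Lemma sigma_processS (I J : set R) X : I `<=` J -> sigma_process I X `<=` sigma_process J X.
Proof.
move=> IJ; apply: sigma_process_sub; first exact: smallest_sigma_algebra.
by move=> s /IJ; exact: sigma_of_process.
Qed.

Lemma sigma_process_algebra (I : set R) X : sigma_algebra setT (sigma_process I X).
Proof. exact: smallest_sigma_algebra. Qed.

(** Turns inclusions of sigma-algebras into measurability on the sample space
    equipped with [G], where the closure properties of measurable functions apply. *)
Lemma sigma_of_measurableP G Y : sigma_algebra setT G ->
  (sigma_of Y `<=` G) <-> measurable_fun (setT : set (g_sigma_algebraType G)) Y.
Proof.
move=> sG; have GE := sigma_algebra_id sG; split.
  by move=> YG _ B mB; rewrite /measurable/= GE; apply: YG; exists B.
by move=> mY A [B mB <-]; have := mY measurableT B mB; rewrite /measurable/= GE.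
Qed.

Lemma sigma_of_sub Y : measurable_fun setT Y -> sigma_of Y `<=` measurable.
Proof. by move=> mY A [B mB <-]; exact: mY. Qed.

Lemma sigma_of_affine G Y Z (a b : R) : sigma_algebra setT G ->
  sigma_of Y `<=` G -> sigma_of Z `<=` G ->
  sigma_of (fun w => a * Y w + b * Z w) `<=` G.
Proof.
move=> sG /(sigma_of_measurableP _ _ sG) mY /(sigma_of_measurableP _ _ sG) mZ.
apply/sigma_of_measurableP => //.
by apply: measurable_funD; exact: measurable_funM.
Qed.

Lemma sigma_of_pre Y A : measurable A -> sigma_of Y (Y @^-1` A).
Proof. by move=> mA; exists A => //; rewrite setTI. Qed.

Lemma sigma_algebraI G A B : sigma_algebra setT G -> G A -> G B -> G (A `&` B).
Proof. by move=> /(sigma_algebraP (fun _ _ => @subsetT _ _))[_ _ _ +]; exact. Qed.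

Lemma sigma_algebraT G : sigma_algebra setT G -> G setT.
Proof. by move=> /(sigma_algebraP (fun _ _ => @subsetT _ _))[]. Qed.

End generated.

(** For [0 <= s <= t] this is the Brownian bridge of length [t] at time [s]. *)
Definition bridge {T : Type} {R : realType} (W : R -> T -> R) (t s : R) (w : T) : R :=
  W s w - s / t * W t w.

Section brownian_bridge.
Context {d} {T : measurableType d} {R : realType} (P : probability T R).
Variables (W : R -> T -> R) (hW : standard_brownian_motion P W).
Local Open Scope ereal_scope.
Local Notation past t := (sigma_process `[0%R, t] W).

Lemma past_measurable t : past t `<=` measurable.
Proof.
apply: sigma_process_sub; first exact: sigma_algebra_measurable.
move=> s /=; rewrite in_itv/= => /andP[s0 _].
by apply: sigma_of_sub; exact: (bm_measurable hW).
Qed.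

Lemma sigma_of_past s t : (0 <= s <= t)%R -> sigma_of (W s) `<=` past t.
Proof. by move=> st; apply: sigma_of_process => /=; rewrite in_itv. Qed.

Lemma sigma_of_bridge r s t : (0 <= s <= t)%R -> (0 <= r <= t)%R ->
  sigma_of (bridge W r s) `<=` past t.
Proof.
move=> st rt.
rewrite (_ : bridge W r s = fun w => 1 * W s w + (- (s / r)) * W r w)%R; last first.
  by apply/funext => w; rewrite mul1r mulNr.
apply: sigma_of_affine; [exact: sigma_process_algebra|exact: sigma_of_past..].
Qed.

Lemma bm_gauss_law t : (0 < t)%R -> forall B, measurable B ->
  P (W t @^-1` B) = normal_prob 0 (Num.sqrt t) B.
Proof.
move=> t0 B mB; rewrite -[in RHS](subr0 t) -(bm_gaussian_increments hW (lexx 0%R) t0)//.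
by congr (P (preimage _ B)); apply/funext => w /=; rewrite (bm_start hW) subr0.
Qed.

Lemma bm_increment_law s t C B : (0 <= s)%R -> (s < t)%R -> past s C -> measurable B ->
  P (C `&` (W t \- W s)%R @^-1` B) = P C * normal_prob 0 (Num.sqrt (t - s)) B.
Proof.
move=> s0 st sC mB; rewrite (bm_indep_increments hW s0 st)//; last exact: sigma_of_pre.
by rewrite (bm_gaussian_increments hW).
Qed.

Lemma measurable_bridge r s : (0 <= s)%R -> (0 <= r)%R -> measurable_fun setT (bridge W r s).
Proof.
move=> s0 r0; apply: measurable_funB; first exact: (bm_measurable hW).
by apply: measurable_funM => //; exact: (bm_measurable hW).
Qed.

(** Given [C], the variables [W s] and [W t - W s] are independent centred
    Gaussians of variances [s] and [t - s]; their sum is [W t] and the residual of the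
    rotation is the bridge of length [t] at time [s]. *)
Lemma bridge_pair_law s t C : (0 < s)%R -> (s < t)%R -> measurable C ->
  (forall A B, measurable A -> measurable B ->
    P (C `&` (W s @^-1` A `&` (W t \- W s)%R @^-1` B)) =
    P C * (normal_prob 0 (Num.sqrt s) A * normal_prob 0 (Num.sqrt (t - s)) B)) ->
  gauss_pair_law P C (bridge W t s) (s * (t - s) / t) (W t) t.
Proof.
move=> s0 st mC CE.
have t0 : (0 < t)%R by exact: lt_trans st.
have mWs := bm_measurable hW (ltW s0).
have mWt := bm_measurable hW (ltW t0).
have := gauss_pair_rotation P C (W s) s (W t \- W s)%R (t - s)%R s0.
rewrite subr_gt0 => /(_ st mC mWs (measurable_funB mWt mWs) CE).
have -> : (s + (t - s) = t)%R by rewrite addrC subrK.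
by congr gauss_pair_law; apply/funext => w /=; rewrite ?/bridge; ring.
Qed.
Lemma gauss_pair_marginal (C : set T) (X : T -> R) (a : R) (Y : T -> R) (b : R) :
  gauss_pair_law P C X a Y b -> gauss_law P C X a /\ gauss_law P C Y b.
Proof.
move=> XY; split => A mA.
  have := XY A setT mA measurableT; rewrite preimage_setT setIT => ->.
  by rewrite probability_setT mule1.
have := XY setT A measurableT mA; rewrite preimage_setT setTI => ->.
by rewrite probability_setT mul1e.
Qed.

(** Bridges of different lengths differ by a multiple of one value: this drives the
    induction below and the decomposition of [beta] on [{t < tau}]. *)
Lemma bridge_sub s t r : (s != 0)%R -> (t != 0)%R ->
  bridge W t r = (fun w => 1 * bridge W s r w + (r / s) * bridge W t s w)%R.
Proof. by move=> s0 t0; apply/funext => w; rewrite /bridge; field; rewrite ?s0 ?t0. Qed.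

(** Induction on the decreasing list of times. For the largest time [s], the bridge
    of length [s] at the other times is independent of [W s] by induction, and it
    belongs to the past of [s], so [bridge_pair_law] makes it independent of the pair
    formed by the bridge of length [t] at [s] and [W t]. By [bridge_sub] these
    generate the bridge of length [t] at all the listed times. *)
Lemma indep_bridge_seq (l : seq R) t : path >%R t l -> all (fun s => 0 < s)%R (t :: l) ->
  indep P (sigma_process [set` l] (bridge W t)) (sigma_of (W t)).
Proof.
elim: l t => [|s l IH] t.
  move=> _ /= /andP[t0 _]; apply: indep_g_sigma_algebra => //.
  - by move=> A B [r].
  - by move=> A [r].
  - exact: (sigma_of_sub _ (bm_measurable hW (ltW t0))).
  - by move=> A B [r].
move=> /= /andP[st sl] /and3P[t0 s0 l0].
have {}IH := IH s sl; rewrite /= s0 in IH; have {}IH := IH l0.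
set Gs := sigma_process [set` l] (bridge W s) in IH.
have les : (0 <= s <= s)%R by rewrite ltW/=.
have Gspast : Gs `<=` past s.
  apply: sigma_process_sub; first exact: sigma_process_algebra.
  move=> r /= rl; apply: sigma_of_bridge; last by rewrite ltW/=.
  have /allP/(_ _ rl) r0 := l0.
  rewrite ltW//=; have := order_path_min (rev_trans lt_trans) sl.
  by move=> /allP /(_ _ rl) /ltW.
have Gsm : Gs `<=` measurable by apply: subset_trans Gspast _; exact: past_measurable.
have law C : Gs C -> gauss_pair_law P C (bridge W t s) (s * (t - s) / t) (W t) t.
  move=> GC; apply: bridge_pair_law => //; first exact: Gsm.
  move=> A B mA mB.
  have WsA : past s (W s @^-1` A).
    by apply: sigma_of_past; [exact: les|exact: sigma_of_pre].
  have CA : past s (C `&` W s @^-1` A).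
    exact: (sigma_algebraI _ _ _ (sigma_process_algebra _ _) (Gspast _ GC) WsA).
  rewrite setIA bm_increment_law//; last exact: ltW.
  by rewrite IH//; [rewrite bm_gauss_law// muleA|exact: sigma_of_pre].
pose Pi : set_system T := [set D | exists C A, [/\ Gs C, measurable A & D = C `&` bridge W t s @^-1` A]].
have sG : sigma_algebra setT Gs by exact: sigma_process_algebra.
have mWt := sigma_of_sub _ (bm_measurable hW (ltW t0)).
have mb : measurable_fun setT (bridge W t s) by apply: measurable_bridge; exact: ltW.
have Pim : Pi `<=` measurable.
  move=> D [C [A [GC mA ->]]]; apply: measurableI; first exact: Gsm.
  by rewrite -[X in measurable X]setTI; exact: mb.
apply: (@indepS _ _ _ _ <<s Pi >> _ (sigma_of (W t)) _) => //; last first.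
  apply: indep_g_sigma_algebra => //.
    move=> D D' [C [A [GC mA ->]]] [C' [A' [GC' mA' ->]]].
    exists (C `&` C'), (A `&` A'); split.
    - exact: (sigma_algebraI _ _ _ sG).
    - exact: measurableI.
    - by rewrite setIACA preimage_setI.
  move=> D E [C [A [GC mA ->]]] [B mB <-]; rewrite setTI -setIA (law C GC)//.
  have [lb lw] := gauss_pair_marginal _ _ _ _ _ (law C GC).
  by rewrite lb// muleA bm_gauss_law.
have sPi : sigma_algebra setT <<s Pi >> by exact: smallest_sigma_algebra.
have bPi : sigma_of (bridge W t s) `<=` <<s Pi >>.
  move=> _ [A mA <-]; apply: sub_sigma_algebra; exists setT, A; split => //.
  exact: sigma_algebraT.
apply: sigma_process_sub => // r /=; rewrite inE => /predU1P[->//|rl].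
rewrite (bridge_sub s t r) ?gt_eqF//; apply: sigma_of_affine => //.
apply: subset_trans (sigma_of_process [set` l] _ _ rl) _ => C GC.
by apply: sub_sigma_algebra; exists C, setT; split => //; rewrite preimage_setT setIT.
Qed.

End brownian_bridge.

Section bridge_laws.
Context {d} {T : measurableType d} {R : realType} (P : probability T R).
Variables (W : R -> T -> R) (hW : standard_brownian_motion P W).
Local Open Scope ereal_scope.
Local Notation past t := (sigma_process `[0%R, t] W).
Local Notation bridge_past t := (sigma_process `[0%R, t] (bridge W t)).

Lemma sigma_of_cst (G : set_system T) (Y : T -> R) (c : R) : sigma_algebra setT G ->
  (forall w, Y w = c) -> sigma_of Y `<=` G.
Proof.
move=> sG Yc; rewrite (_ : Y = cst c); last exact/funext.
by apply/(sigma_of_measurableP _ _ sG); exact: measurable_cst.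
Qed.

Lemma bridge_at_end t (w : T) : (t != 0)%R -> bridge W t t w = 0%R.
Proof. by move=> t0; rewrite /bridge divff// mul1r subrr. Qed.

Lemma bridge_at_0 t w : bridge W t 0 w = 0%R.
Proof. by rewrite /bridge (bm_start hW) mul0r mul0r subrr. Qed.

(** Events that depend on finitely many times form a pi-system; the times [0] and
    [t], where the bridge vanishes, can be left out, and the others be sorted. *)
Lemma indep_bridge t : (0 < t)%R -> indep P (bridge_past t) (sigma_of (W t)).
Proof.
move=> t0.
pose Pi := [set A | exists2 l : seq R, (forall s, s \in l -> 0 <= s <= t)%R &
  sigma_process [set` l] (bridge W t) A].
have mWt := sigma_of_sub _ (bm_measurable hW (ltW t0)).
have lm (l : seq R) : (forall s, s \in l -> 0 <= s <= t)%R ->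
    sigma_process [set` l] (bridge W t) `<=` measurable.
  move=> lt; apply: sigma_process_sub; first exact: sigma_algebra_measurable.
  move=> s /= /lt /andP[s0 _]; apply: sigma_of_sub.
  exact: (measurable_bridge P _ hW _ _ s0 (ltW t0)).
apply: (@indepS _ _ _ _ <<s Pi >> _ (sigma_of (W t)) _) => //; last first.
  apply: indep_g_sigma_algebra => //.
  - move=> A B [l lt lA] [m mt mB]; exists (l ++ m).
      by move=> s; rewrite mem_cat => /orP[/lt|/mt].
    apply: (sigma_algebraI _ _ _ (sigma_process_algebra _ _)).
      by apply: (sigma_processS [set` l]) => // s /= sl; rewrite mem_cat sl.
    by apply: (sigma_processS [set` m]) => // s /= sl; rewrite mem_cat sl orbT.
  - by move=> A [l lt lA]; exact: lm lA.
  move=> A B [l lt lA] WB.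
  (* removing 0 and t makes the bridge lemma for strictly decreasing times apply *)
  pose m := rev (sort <=%R (undup [seq s <- l | 0 < s < t]%R)).
  have mE s : s \in m = (s \in l) && (0 < s < t)%R.
    by rewrite mem_rev mem_sort mem_undup mem_filter andbC.
  apply: (indep_bridge_seq P _ hW m t) => //.
  - rewrite path_min_sorted; last by apply/allP => s; rewrite mE => /and3P[].
    by rewrite rev_sorted sort_lt_sorted undup_uniq.
  - by rewrite /= t0; apply/allP => s; rewrite mE => /and3P[].
  move: A lA; apply: sigma_process_sub; first exact: sigma_process_algebra.
  move=> s /= sl; have /andP[s0 st] := lt _ sl.
  have [sm|] := boolP (s \in m); first exact: sigma_of_process.
  rewrite mE sl/= negb_and -!leNgt => sm.
  apply: (sigma_of_cst _ _ 0%R); first exact: sigma_process_algebra.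
  move=> w; have /orP[s0'|ts] := sm.
    by rewrite (_ : s = 0%R) ?bridge_at_0//; apply/le_anti; rewrite s0 s0'.
  rewrite (_ : s = t) ?bridge_at_end ?gt_eqF//.
  by apply/le_anti; rewrite st ts.
apply: sigma_process_sub; first exact: smallest_sigma_algebra.
move=> s /=; rewrite in_itv/= => s0t A sA; apply: sub_sigma_algebra.
exists [:: s]; first by move=> r; rewrite inE => /eqP ->.
apply: (sigma_of_process [set` [:: s]] _ s _ _ sA); exact: mem_head.
Qed.

Lemma bridge_past_sub t : bridge_past t `<=` past t.
Proof.
apply: sigma_process_sub; first exact: sigma_process_algebra.
move=> s /=; rewrite in_itv/= => /andP[s0 st].
by apply: sigma_of_bridge; rewrite ?s0//= lexx (le_trans s0).
Qed.

Lemma bridge_past_measurable t : bridge_past t `<=` measurable.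
Proof.
exact: subset_trans (bridge_past_sub t) (past_measurable P _ hW t).
Qed.

Lemma law_bridge_mid t r C : (0 < t)%R -> (t < r)%R -> bridge_past t C ->
  gauss_pair_law P C (bridge W r t) (t * (r - t) / r) (W r) r.
Proof.
move=> t0 tr BC.
have bC : measurable C := bridge_past_measurable t _ BC.
apply: (bridge_pair_law P _ hW) => // A B mA mB.
have WtA : past t (W t @^-1` A).
  by apply: (sigma_of_past W t t); rewrite ?lexx ?ltW//; exact: sigma_of_pre.
have CA : past t (C `&` W t @^-1` A).
  by apply: (sigma_algebraI _ _ _ (sigma_process_algebra _ _)) => //; exact: bridge_past_sub.
rewrite setIA (bm_increment_law P _ hW)//; last exact: ltW.
by rewrite (indep_bridge t t0)//; [rewrite (bm_gauss_law P _ hW)// muleA|exact: sigma_of_pre].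
Qed.

(** Residual of the bridge of length [r] at time [u] after its regression on the
    value at time [t]. *)
Definition bridge_innov (r t u : R) (w : T) : R :=
  bridge W r u w - (r - u) / (r - t) * bridge W r t w.

(** The residual is the bridge, at time [u], of the increments of [W] over
    [[t, r]]. In particular it does not involve the path before [t]. *)
Lemma bridge_innovE r t u : (0 < t)%R -> (t < r)%R -> bridge_innov r t u =
  (fun w => (W u w - W t w) - (u - t) / (r - t) * ((W u w - W t w) + (W r w - W u w)))%R.
Proof.
move=> t0 tr; apply/funext => w; rewrite /bridge_innov /bridge; field.
by rewrite subr_eq0 !gt_eqF// (lt_trans t0).
Qed.

(** Apply the rotation to the increments over [[t, u]] and [[u, r]]: given the past of
    [t], the residual is independent of [W r - W t]. Then add the residual to the
    conditioning event and apply the rotation to [W t] and [W r - W t]. *)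
Lemma law_bridge_innov t u r C : (0 < t)%R -> (t < u)%R -> (u < r)%R -> bridge_past t C ->
  gauss_pair_law P C (bridge W r t) (t * (r - t) / r)
    (bridge_innov r t u) ((u - t) * (r - u) / (r - t)).
Proof.
move=> t0 tu ur BC.
have tr : (t < r)%R by exact: lt_trans ur.
have u0 : (0 < u)%R by exact: lt_trans tu.
have r0 : (0 < r)%R by exact: lt_trans ur.
have mW s : (0 < s)%R -> measurable_fun setT (W s) by move=> /ltW; exact: (bm_measurable hW).
have mWB s s' : (0 < s)%R -> (0 < s')%R -> measurable_fun setT (W s \- W s')%R.
  by move=> s0 s'0; apply: measurable_funB; exact: mW.
set v := ((u - t) * (r - u) / (r - t))%R.
have mC : measurable C := bridge_past_measurable t _ BC.
have past_t A D : measurable A -> bridge_past t D -> past t (D `&` W t @^-1` A).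
  move=> mA BD; apply: (sigma_algebraI _ _ _ (sigma_process_algebra _ _)).
    exact: bridge_past_sub.
  by apply: (sigma_of_past W t t); rewrite ?lexx ?ltW//; exact: sigma_of_pre.
have law1 D : past t D ->
    gauss_pair_law P D (bridge_innov r t u) v (W r \- W t)%R (r - t).
  move=> pD; have mD := past_measurable P _ hW t _ pD.
  have := gauss_pair_rotation P D (W u \- W t)%R (u - t)%R (W r \- W u)%R (r - u)%R.
  rewrite !subr_gt0 => /(_ tu ur mD (mWB u t u0 t0) (mWB r u r0 u0)).
  rewrite (_ : (u - t + (r - u) = r - t)%R); last by ring.
  rewrite (_ : (W u \- W t) \+ (W r \- W u) = W r \- W t)%R; last first.
    by apply/funext => w /=; ring.
  rewrite bridge_innovE//; apply => A B mA mB.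
  have past_u : past u (D `&` (W u \- W t)%R @^-1` A).
    apply: (sigma_algebraI _ _ _ (sigma_process_algebra _ _)).
      apply: (sigma_processS _ _ _ _ _ pD) => s /=; rewrite !in_itv/= => /andP[->/= st].
      exact: le_trans (ltW tu).
    rewrite (_ : (W u \- W t)%R = (fun w => 1 * W u w + (-1) * W t w)%R); last first.
      by apply/funext => w; rewrite mul1r mulN1r.
    apply: (@sigma_of_affine _ _ _ (past u)); last exact: sigma_of_pre.
    - exact: sigma_process_algebra.
    - by apply: sigma_of_past; rewrite lexx ltW.
    - by apply: sigma_of_past; rewrite !ltW.
  rewrite setIA (bm_increment_law P _ hW)//; last exact: ltW.
  by rewrite (bm_increment_law P _ hW)// ?muleA//; exact: ltW.
have mI : measurable_fun setT (bridge_innov r t u).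
  by apply: measurable_funB => //; [|apply: measurable_funM => //];
    apply: (measurable_bridge P _ hW); exact: ltW.
move=> A B mA mB.
have mIB : measurable (bridge_innov r t u @^-1` B).
  by rewrite -[X in measurable X]setTI; exact: mI.
pose E := C `&` bridge_innov r t u @^-1` B.
have PE : P E = P C * normal_prob 0 (Num.sqrt v) B.
  apply: (proj1 (gauss_pair_marginal P C _ _ _ _ (law1 C _))) => //.
  exact: bridge_past_sub.
have -> : C `&` (bridge W r t @^-1` A `&` bridge_innov r t u @^-1` B) =
  E `&` bridge W r t @^-1` A by rewrite /E setIA setIAC.
have mE : measurable E by exact: measurableI.
have lawE : gauss_pair_law P E (bridge W r t) (t * (r - t) / r) (W r) r.
  apply: (bridge_pair_law P _ hW) => // A1 A2 mA1 mA2.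
  have -> : E `&` (W t @^-1` A1 `&` (W r \- W t)%R @^-1` A2) =
     (C `&` W t @^-1` A1) `&` (bridge_innov r t u @^-1` B `&` (W r \- W t)%R @^-1` A2).
    by rewrite /E setIACA !setIA.
  etransitivity; first exact: (law1 _ (past_t _ _ mA1 BC) _ _ mB mA2).
  rewrite (indep_bridge t t0 C _ BC (sigma_of_pre _ _ mA1)).
  rewrite (bm_gauss_law P _ hW t t0 _ mA1) PE.
  move: (P C) (normal_prob 0 (Num.sqrt t) A1) (normal_prob 0 (Num.sqrt v) B).
  by move: (normal_prob 0 _ A2) => x y z s; rewrite muleACA.
have [lawEA _] := gauss_pair_marginal P E _ _ _ _ lawE.
rewrite (lawEA _ mA) PE.
move: (P C) (normal_prob 0 (Num.sqrt v) B) (normal_prob 0 _ A) => x y z.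
by rewrite -muleA (muleC y).
Qed.

End bridge_laws.

(** * Joint measurability and random times *)

Section joint_measurability.
Context {d} {T : measurableType d} {R : realType}.
Variables (W : R -> T -> R).
Hypothesis mW : forall t, 0 <= t -> measurable_fun setT (W t).
Hypothesis cW : forall w, {within `[0, +oo[, continuous (W ^~ w)}.

Let grid n (r : R) : R := (Num.truncn (`|r| * n.+1%:R))%:R / n.+1%:R.

Let grid_ge0 n r : 0 <= grid n r.
Proof. by rewrite divr_ge0. Qed.

Let grid_cvg r : grid n r @[n --> \oo] --> `|r|.
Proof.
apply/cvgrPdist_le => e e0; near=> n.
have n0 : (0 : R) < n.+1%:R by [].
have /andP[h1 h2] := truncn_itv (mulr_ge0 (normr_ge0 r) (ltW n0)).
have le1 : grid n r <= `|r| by rewrite /grid ler_pdivrMr.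
rewrite ger0_norm ?subr_ge0//.
rewrite (@le_trans _ _ (n.+1%:R^-1))//; last first.
  by apply: ltW; near: n; exact: (near_infty_natSinv_lt (PosNum e0)).
rewrite lerBlDr /grid -[X in X + _]mul1r -mulrDl ler_pdivlMr//.
by rewrite addrC natr1 ltW.
Unshelve. all: by end_near. Qed.

(** A continuous path is the pointwise limit of its values on the grids of mesh
    [1 / n.+1], and on each cell of a grid the discretised process is a fixed [W s].
    Negative times are folded by the absolute value, as the path is only known to be
    continuous on the half-line. *)
Lemma measurable_process_joint : measurable_fun setT (fun z : R * T => W `|z.1| z.2).
Proof.
apply: (@measurable_fun_cvg _ _ _ _ (fun n (z : R * T) => W (grid n z.1) z.2)).
- move=> n _ B mB; rewrite setTI.
  rewrite (_ : _ @^-1` B = \bigcup_k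
     ([set r | Num.truncn (`|r| * n.+1%:R) = k] `*` (W (k%:R / n.+1%:R) @^-1` B))); last first.
    apply/seteqP; split => [[r w] /= h|[r w] [k _ /= [<- //]]].
    by exists (Num.truncn (`|r| * n.+1%:R)).
  apply: bigcupT_measurable => k; apply: measurableX.
    have mn : measurable_fun setT (fun r : R => `|r| * n.+1%:R).
      by apply: measurable_funM => //; exact: measurableT_comp.
    rewrite (_ : [set _ | _] = [set r | k%:R <= `|r| * n.+1%:R] `&`
        [set r | `|r| * n.+1%:R < k.+1%:R]); last first.
      have trE r : Num.truncn (`|r| * n.+1%:R) = k <->
          k%:R <= `|r| * n.+1%:R < k.+1%:R.
        by rewrite -truncn_eq ?mulr_ge0//; split => [->|/eqP].
      by apply/seteqP; split => r /=; [move=> /trE/andP[]|move=> [h1 h2]; apply/trE/andP].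
    apply: measurableI; rewrite -[X in measurable X]setTI.
      exact: measurable_fun_le.
    have h : measurable_fun setT (fun r : R => `|r| * n.+1%:R < k.+1%:R).
      exact: measurable_fun_ltr.
    exact: (h measurableT [set true]).
  by rewrite -[X in measurable X]setTI; apply: mW => //; exact: divr_ge0.
- move=> [r w] _ /=.
  have /subspace_continuousP/(_ `|r|) := cW w.
  rewrite /= in_itv/= normr_ge0 => /(_ isT) h.
  have wgrid : grid n r @[n --> \oo] --> within `[0, +oo[ (nbhs `|r|).
    move=> U /= rU; have := grid_cvg r _ rU.
    rewrite !near_simpl => gU; near=> n.
    have := near gU n; apply => //.
    by rewrite /= in_itv/= grid_ge0.
  exact: cvg_comp wgrid h.
Unshelve. all: by end_near. Qed.

End joint_measurability.

Section mixing.
Context {d} {T : measurableType d} {R : realType} (P : probability T R).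
Variables (W : R -> T -> R) (hW : standard_brownian_motion P W).
Variable tau : {RV P >-> R}.
Hypothesis hind : indep P (sigma_of tau) (sigma_process `[0, +oo[ W).
Local Open Scope ereal_scope.

Local Notation gen := (\bigcup_(s in `[0%R, +oo[) sigma_of (W s)).
Local Notation pathType := (g_sigma_algebraType gen).

Lemma measurable_path t : (0 <= t)%R -> measurable_fun (setT : set pathType) (W t).
Proof.
move=> t0 _ B mB; apply: sub_sigma_algebra.
by exists t; [rewrite /= in_itv/= t0|exists B].
Qed.

(** The length of the bridge is a free variable here, so that it can be replaced by
    the random time [tau] and be integrated out separately. *)
Lemma measurable_info_joint s : (0 < s)%R ->
  measurable_fun setT (fun z : R * pathType => information_process W (fun _ => z.1) s z.2).
Proof.
move=> s0.
have mW1 : measurable_fun setT (fun z : R * pathType => W s z.2).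
  by apply: (measurableT_comp (measurable_path s (ltW s0))).
have mmax : measurable_fun setT (fun z : R * pathType => Num.max z.1 s).
  exact: measurable_maxr.
have mW2 : measurable_fun setT (fun z : R * pathType => W (Num.max z.1 s) z.2).
  rewrite (_ : (fun z => _) = (fun z : R * pathType => W `|z.1|%R z.2) \o
      (fun z : R * pathType => (Num.max z.1 s, z.2))); last first.
    by apply/funext => z /=; rewrite ger0_norm// le_max (ltW s0) orbT.
  apply: measurableT_comp; last exact: measurable_fun_pair.
  apply: (@measurable_process_joint _ pathType R W); first exact: measurable_path.
  exact: bm_continuous hW.
apply: measurable_funB => //; apply: measurable_funM => //.
by apply: measurable_funM => //; exact: measurable_fun_inv.
Qed.

Lemma path_measurable : sigma_process `[0%R, +oo[ W `<=` measurable.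
Proof.
apply: sigma_process_sub; first exact: sigma_algebra_measurable.
move=> s /=; rewrite in_itv/= andbT => s0.
by apply: sigma_of_sub; exact: (bm_measurable hW).
Qed.

Lemma measurable_to_path : @measurable_fun _ _ T pathType setT idfun.
Proof. by move=> _ B mB; rewrite setTI; exact: path_measurable. Qed.

(** By independence the pair formed by [tau] and the path has a product law. The path
    is represented by the sample space with the sigma-algebra generated by [W], on
    which the second marginal is the restriction of [P]. *)
Lemma ge0_integral_mix (F : R * pathType -> \bar R) :
  measurable_fun setT F -> (forall z, 0 <= F z) ->
  \int[P]_w F (tau w, w) = \int[distribution P tau]_r \int[P]_w F (r, w).
Proof.
move=> mF F0.
pose toPath : T -> pathType := idfun.
have mtoPath : measurable_fun setT toPath by exact: measurable_to_path.
pose mm := isMeasurableFun.Build _ _ _ _ toPath mtoPath.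
pose toPathM : {mfun T >-> pathType} := HB.pack toPath mm.
pose Q : probability pathType R := distribution P toPathM.
have E A B : measurable A -> measurable B ->
    P (setT `&` (tau @^-1` A `&` toPath @^-1` B)) = distribution P tau A * Q B.
  by move=> mA mB; rewrite setTI; apply: hind => //; exact: sigma_of_pre.
etransitivity.
  exact: (ge0_integral_pair_law P (distribution P tau) Q setT tau toPath F
    measurableT (measurable_funPT tau) mtoPath E mF F0).
apply: eq_integral => r _.
have mFr : measurable_fun setT (fun w : pathType => F (r, w)) by exact: measurable_fun_pair2.
etransitivity; first exact: (ge0_integral_pushforward mtoPath P measurableT mFr).
by [].
Qed.

Lemma measurable_info s : (0 < s)%R -> measurable_fun setT (information_process W tau s).
Proof.
move=> s0.
have -> : information_process W tau s =
  (fun z : R * pathType => information_process W (fun _ => z.1) s z.2) \o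
  (fun w => (tau w, w)) by [].
apply: measurableT_comp; first exact: measurable_info_joint.
by apply: measurable_fun_pair => //; exact: measurable_to_path.
Qed.

Lemma info_bridge (r s : R) : (s <= r)%R ->
  information_process W (fun _ : T => r) s = bridge W r s.
Proof. by move=> sr; apply/funext => w; rewrite /information_process /bridge max_l. Qed.

Lemma info_after (X : T -> R) s w : (0 < s)%R -> (X w <= s)%R ->
  information_process W X s w = 0%R.
Proof.
by move=> s0 Xs; rewrite /information_process max_r// divff ?gt_eqF// mul1r subrr.
Qed.

End mixing.

(** * The law of the bridge of a given length *)

Section given_length.
Context {d} {T : measurableType d} {R : realType} (P : probability T R).
Variables (W : R -> T -> R) (hW : standard_brownian_motion P W).
Variables (t u : R) (t0 : 0 < t) (tu : t < u).
Variables (g : R * R -> R) (mg : measurable_fun setT g) (g0 : forall z, 0 <= g z).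
Local Open Scope ereal_scope.
Local Notation bridge_past t := (sigma_process `[0%R, t] (bridge W t)).
Local Notation mu := (@lebesgue_measure R).

(** The conditional mean of [g (r, beta u)] given [beta t = x], for a bridge of
    length [r]; the bridge has come to rest at time [u] if [r <= u]. *)
Definition cond_mean (r x : R) : \bar R :=
  if (r <= u)%R then (g (r, 0%R))%:E else
  \int[mu]_y (g (r, y) *
    gauss ((r - u) / (r - t) * (u - t)) y ((r - u) / (r - t) * x))%:E.

Lemma cond_mean_ge0 r x : 0 <= cond_mean r x.
Proof.
rewrite /cond_mean; case: ifP => _; first by rewrite lee_fin.
by apply: integral_ge0 => y _; rewrite lee_fin mulr_ge0// gauss_ge0.
Qed.

Lemma measurable_cond_mean : measurable_fun setT (fun z : R * R => cond_mean z.1 z.2).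
Proof.
apply: measurable_fun_ifT.
- exact: measurable_fun_ler.
- apply/measurable_EFinP; apply: measurableT_comp => //.
  exact: measurable_fun_pair.
pose F (z : (R * R) * R) : \bar R := (g (z.1.1, z.2) *
    gauss ((z.1.1 - u) / (z.1.1 - t) * (u - t)) z.2
      ((z.1.1 - u) / (z.1.1 - t) * z.1.2))%:E.
have m11 : measurable_fun setT (fun z : (R * R) * R => z.1.1).
  exact: measurableT_comp.
have m12 : measurable_fun setT (fun z : (R * R) * R => z.1.2).
  exact: measurableT_comp.
have mr : measurable_fun setT (fun z : (R * R) * R => (z.1.1 - u) / (z.1.1 - t))%R.
  apply: measurable_funM; first exact: measurable_funB.
  by apply: measurable_fun_inv; exact: measurable_funB.
have mF : measurable_fun setT F.
  apply/measurable_EFinP; apply: measurable_funM.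
    by apply: measurableT_comp => //; exact: measurable_fun_pair.
  by apply: measurable_fun_gauss => //; exact: measurable_funM.
have F0 z : 0 <= F z by rewrite lee_fin mulr_ge0// gauss_ge0.
exact: (measurable_fun_fubini_tonelli_F (m2 := mu) F mF F0).
Qed.

Lemma measurable_varphi : measurable_fun setT (fun z : R * R => varphi t z.1 z.2).
Proof.
apply: measurable_fun_ifT => //; first by rewrite t0/=; exact: measurable_fun_ltr.
apply: measurable_fun_gauss => //; apply: measurable_funM; last exact: measurable_fun_inv.
by apply: measurable_funM => //; exact: measurable_funB.
Qed.

Lemma varphi_ge0 r x : (0 <= varphi t r x)%R.
Proof. by rewrite /varphi; case: ifP => // _; exact: gauss_ge0. Qed.

(** For [r <= u] only the law of the bridge at time [t] matters. For [u < r] the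
    bridge at [u] is the multiple [(r - u) / (r - t)] of its value at [t] plus the
    independent Gaussian residual, and a translation turns the integral over the
    residual into the one in [cond_mean]. *)
Lemma integral_given_length (r : R) (C : set T) (k : R -> \bar R) : (t < r)%R ->
  bridge_past t C -> measurable_fun setT k -> (forall x, 0 <= k x) ->
  \int[P]_(w in C) (k (information_process W (fun _ => r) t w) *
    (g (r, information_process W (fun _ => r) u w))%:E) =
  P C * \int[mu]_x (k x * cond_mean r x * (varphi t r x)%:E).
Proof.
move=> tr BC mk k0.
have r0 : (0 < r)%R by exact: lt_trans tr.
have u0 : (0 < u)%R by exact: lt_trans tu.
have mC : measurable C by exact: (bridge_past_measurable P _ hW t _ BC).
have v0 : (0 < t * (r - t) / r)%R by rewrite divr_gt0// mulr_gt0// subr_gt0.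
have phiE x : varphi t r x = gauss (t * (r - t) / r) x 0.
  by rewrite /varphi t0 tr.
have mbt : measurable_fun setT (bridge W r t) by apply: (measurable_bridge P _ hW); exact: ltW.
have mbu : measurable_fun setT (bridge W r u) by apply: (measurable_bridge P _ hW); exact: ltW.
have mkc : measurable_fun setT (fun x => k x * cond_mean r x).
  apply: emeasurable_funM => //.
  have mr : measurable_fun setT (fun x : R => (r, x)) by exact: measurable_fun_pair.
  exact: (measurableT_comp measurable_cond_mean mr).
have kc0 x : 0 <= k x * cond_mean r x by rewrite mule_ge0// cond_mean_ge0.
under [X in _ = _ * X]eq_integral do rewrite phiE.
rewrite -(ge0_integral_gauss _ _ v0 mkc kc0) info_bridge; last exact: ltW.
have [ru|ur] := leP r u.
  pose f (z : R * R) := k z.1 * (g (r, 0%R))%:E.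
  have mf : measurable_fun setT f.
    by apply: emeasurable_funM => //; exact: measurableT_comp.
  have f0 z : 0 <= f z by rewrite mule_ge0// lee_fin.
  have law := law_bridge_mid P W hW t r C t0 tr BC.
  have mWr : measurable_fun setT (W r) := bm_measurable hW (ltW r0).
  transitivity (\int[P]_(w in C) f (bridge W r t w, W r w)).
    by apply: eq_integral => w _; rewrite /f/= (info_after W _ u)//.
  etransitivity; first exact: (ge0_integral_gauss_pair P C _ _ _ _ f mC mbt mWr law mf f0).
  congr (_ * _); apply: eq_integral => x _; rewrite /f/= /cond_mean ru.
  etransitivity; first exact: (integral_cst (normal_prob 0 (Num.sqrt r)) measurableT).
  by rewrite [X in _ * X](probability_setT (normal_prob 0 (Num.sqrt r))) mule1.
set c := ((r - u) / (r - t))%R.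
have v1 : (0 < (u - t) * (r - u) / (r - t))%R.
  by rewrite divr_gt0// ?mulr_gt0// subr_gt0.
have vE : (c * (u - t) = (u - t) * (r - u) / (r - t))%R by rewrite /c mulrC mulrA.
pose f (z : R * R) := k z.1 * (g (r, c * z.1 + z.2)%R)%:E.
have mf : measurable_fun setT f.
  apply: emeasurable_funM; first exact: measurableT_comp.
  apply/measurable_EFinP; apply: measurableT_comp => //.
  apply: measurable_fun_pair => //; apply: measurable_funD => //.
  exact: measurable_funM.
have f0 z : 0 <= f z by rewrite mule_ge0// lee_fin.
have mI : measurable_fun setT (bridge_innov W r t u).
  by apply: measurable_funB => //; exact: measurable_funM.
transitivity (\int[P]_(w in C) f (bridge W r t w, bridge_innov W r t u w)).
  apply: eq_integral => w _; rewrite info_bridge; last exact: ltW.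
  by rewrite /f/= /bridge_innov -/c addrC subrK.
have law := law_bridge_innov P W hW t u r C t0 tu ur BC.
etransitivity; first exact: (ge0_integral_gauss_pair P C _ _ _ _ f mC mbt mI law mf f0).
congr (_ * _); apply: eq_integral => x _.
have mgx : measurable_fun setT (fun y => (g (r, c * x + y)%R)%:E).
  apply/measurable_EFinP; apply: measurableT_comp => //.
  by apply: measurable_fun_pair => //; exact: measurable_funD.
have gx0 y : 0 <= (g (r, c * x + y)%R)%:E by rewrite lee_fin.
rewrite /f/= ge0_integralZl//.
congr (_ * _); rewrite ge0_integral_gauss//.
rewrite /cond_mean leNgt ur/=.
pose h y := (g (r, y) * gauss (c * (u - t)) y (c * x))%:E.
have mh : measurable_fun setT h.
  apply/measurable_EFinP; apply: measurable_funM; last exact: measurable_fun_gauss.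
  by apply: measurableT_comp => //; exact: measurable_fun_pair.
have h0 y : 0 <= h y by rewrite lee_fin mulr_ge0// gauss_ge0.
transitivity (\int[mu]_y h (y + c * x)%R); last exact: (ge0_integral_shift _ _ mh h0).
by apply: eq_integral => y _; rewrite /h -EFinM vE /gauss subr0 addrK [(y + _)%R]addrC.
Qed.

End given_length.

(** * Averaging over the length *)

Section mixture.
Context {d} {T : measurableType d} {R : realType} (P : probability T R).
Variables (W : R -> T -> R) (hW : standard_brownian_motion P W).
Variable tau : {RV P >-> R}.
Hypothesis hind : indep P (sigma_of tau) (sigma_process `[0, +oo[ W).
Variables (t u : R) (t0 : 0 < t) (tu : t < u).
Variables (g : R * R -> R) (mg : measurable_fun setT g) (g0 : forall z, 0 <= g z).
Local Open Scope ereal_scope.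
Local Notation bridge_past t := (sigma_process `[0%R, t] (bridge W t)).
Local Notation mu := (@lebesgue_measure R).
Local Notation beta := (information_process W tau).

(** Unnormalised conditional mean of [g (tau, beta u)] on [{t < tau}] given
    [beta t = x]; for [g = 1] it is the density of [beta t] on [{t < tau}]. *)
Definition joint_mean (x : R) : \bar R :=
  \int[distribution P tau]_(r in `]t, +oo[) (cond_mean t u g r x * (varphi t r x)%:E).

Let integrand (z : R * R) : \bar R :=
  (\1_(`]t, +oo[%classic) z.1)%:E * (cond_mean t u g z.1 z.2 * (varphi t z.1 z.2)%:E).

Let m_ind : measurable_fun setT (fun z : R * R => (\1_(`]t, +oo[%classic) z.1 : R)%:E).
Proof.
apply/measurable_EFinP; apply: (measurableT_comp (measurable_indic _)) => //.
Qed.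

Let m_integrand : measurable_fun setT integrand.
Proof.
apply: emeasurable_funM => //; apply: emeasurable_funM.
  exact: measurable_cond_mean.
by apply/measurable_EFinP; exact: measurable_varphi.
Qed.

Let integrand_ge0 z : 0 <= integrand z.
Proof. by rewrite mule_ge0 ?lee_fin// mule_ge0 ?cond_mean_ge0// lee_fin varphi_ge0. Qed.

Let joint_meanE x : joint_mean x = \int[distribution P tau]_r integrand (r, x).
Proof.
rewrite /joint_mean integral_mkcond; apply: eq_integral => r _.
by rewrite patchE /integrand indicE; case: (r \in _); rewrite ?mul1e ?mul0e.
Qed.

Lemma joint_mean_ge0 x : 0 <= joint_mean x.
Proof. by rewrite joint_meanE integral_ge0. Qed.

Lemma measurable_joint_mean : measurable_fun setT joint_mean.
Proof.
rewrite (_ : joint_mean = fubini_G (distribution P tau) integrand); last first.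
  by apply/funext => x; rewrite joint_meanE.
exact: measurable_fun_fubini_tonelli_G.
Qed.

(** This contains the Markov property: [C] comes from the bridge of length [t] and
    enters through its probability only. Average [integral_given_length] over the law
    of [tau] and exchange the integrals over the length and over the value at [t]. *)
Lemma integral_joint_mean (C : set T) (k : R -> \bar R) :
  bridge_past t C -> measurable_fun setT k -> (forall x, 0 <= k x) ->
  \int[P]_(w in C `&` [set w | (t < tau w)%R]) (k (beta t w) * (g (tau w, beta u w))%:E) =
  P C * \int[mu]_x (k x * joint_mean x).
Proof.
move=> BC mk k0.
have u0 : (0 < u)%R by exact: lt_trans tu.
have mC : measurable C by exact: (bridge_past_measurable P _ hW t _ BC).
pose gen := \bigcup_(s in `[0%R, +oo[) sigma_of (W s).
pose pathType := g_sigma_algebraType gen.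
have mCp : @measurable _ pathType C.
  have past_path : sigma_process `[0%R, t] W `<=` sigma_process `[0%R, +oo[ W.
    by apply: sigma_processS => s /=; rewrite !in_itv/= => /andP[->].
  by apply: past_path; exact: (bridge_past_sub W t _ BC).
pose b s (z : R * pathType) := information_process W (fun _ => z.1) s z.2.
have mb s : (0 < s)%R -> measurable_fun setT (b s).
  exact: (measurable_info_joint P W hW).
pose F (z : R * pathType) : \bar R :=
  (\1_(`]t, +oo[%classic) z.1)%:E * ((\1_C z.2)%:E * (k (b t z) * (g (z.1, b u z))%:E)).
have mF : measurable_fun setT F.
  apply: emeasurable_funM.
    apply/measurable_EFinP; apply: (measurableT_comp (measurable_indic _)) => //.
  apply: emeasurable_funM.
    by apply/measurable_EFinP; apply: (measurableT_comp (measurable_indic mCp)).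
  apply: emeasurable_funM; first by apply: measurableT_comp => //; exact: mb.
  apply/measurable_EFinP; apply: measurableT_comp => //.
  by apply: measurable_fun_pair => //; exact: mb.
have F0 z : 0 <= F z.
  by rewrite mule_ge0 ?lee_fin// mule_ge0 ?lee_fin// mule_ge0// lee_fin.
have tE r : (r \in (`]t, +oo[%classic : set R)) = (t < r)%R.
  by apply/idP/idP; rewrite inE/= in_itv/= andbT.
transitivity (\int[P]_w F (tau w, w)).
  rewrite integral_mkcond; apply: eq_integral => w _.
  rewrite patchE; have -> : (w \in C `&` [set w | (t < tau w)%R]) = (w \in C) && (t < tau w)%R.
    by rewrite in_setI; congr andb; apply/idP/idP; rewrite inE.
  rewrite /F/= !indicE tE.
  by case: (w \in C); case: (t < tau w)%R; rewrite /= ?mul0e ?mule0 ?mul1e.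
etransitivity; first exact: (ge0_integral_mix P W hW tau hind F mF F0).
pose G r := \int[mu]_x (k x * integrand (r, x)).
have mki : measurable_fun setT (fun z : R * R => k z.2 * integrand z).
  by apply: emeasurable_funM => //; exact: measurableT_comp.
have ki0 z : 0 <= k z.2 * integrand z by exact: mule_ge0.
transitivity (\int[distribution P tau]_r (P C * G r)).
  apply: eq_integral => r _; rewrite /F /G /integrand /= indicE tE.
  have [tr|tr] := ltP t r; rewrite /=; last first.
    by rewrite !integral0_eq ?mule0// => x _; rewrite ?mul0e ?mule0.
  rewrite -[RHS](_ : P C * \int[mu]_x (k x * cond_mean t u g r x * (varphi t r x)%:E) = _).
    rewrite -(integral_given_length P W hW t u t0 tu g mg g0 r C k tr BC mk k0).
    rewrite [RHS]integral_mkcond; apply: eq_integral => w _.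
    by rewrite mul1e patchE indicE; case: (w \in C); rewrite ?mul1e ?mul0e.
  by congr (_ * _); apply: eq_integral => x _; rewrite mul1e muleA.
have mG : measurable_fun setT G.
  exact: (measurable_fun_fubini_tonelli_F (m2 := mu) _ mki ki0).
have G0 r : 0 <= G r by apply: integral_ge0 => x _; exact: (ki0 (r, x)).
rewrite ge0_integralZl//; congr (_ * _).
etransitivity.
  exact: (fubini_tonelli (m1 := distribution P tau) (m2 := mu) _ mki ki0).
apply: eq_integral => x _; rewrite joint_meanE /= ge0_integralZl//.
  by apply: measurable_fun_pair1.
Qed.

End mixture.

(** * Conditional expectations *)

Section distribution.
Context {d} {T : measurableType d} {R : realType} (P : probability T R).
Variable tau : {RV P >-> R}.
Local Open Scope ereal_scope.

(** Both measures give [F b - F a] to the interval from [a] to [b]. *)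
Lemma dF_distribution (A : set R) : measurable A -> dF tau A = distribution P tau A.
Proof.
have mtau : @measurable_fun _ _ T (measurableTypeR R) setT tau := measurable_funPT tau.
move=> mA; pose m0 : {measure set (measurableTypeR R) -> \bar R} :=
  pushforward P (tau : T -> measurableTypeR R).
pose m := m0 mtau.
apply: (@lebesgue_stieltjes_measure_unique R _ m) => // _ [[a b]]/= _ <-.
rewrite /lebesgue_stieltjes_measure /measure_extension/=.
rewrite measurable_mu_extE/=; last exact: is_ocitv.
have [ab | ba] := leP a b; last first.
  by rewrite set_itv_ge ?wlength0 ?measure0// bnd_simp -leNgt ltW.
rewrite wlength_itv_bnd// EFinB !fineK ?fin_num_measure//.
rewrite (_ : `]a, b]%classic = `]-oo, b] `\` `]-oo, a]); last first.
  by rewrite -[RHS]setCK setCD setCitvl setUC -[LHS]setCK setCitv.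
rewrite [RHS]measureD ?setIidr//; first exact: subset_itvl.
apply: (@le_lt_trans _ _ 1); last exact: ltry.
by apply: (probability_le1 P); rewrite -[X in measurable X]setTI; exact: (measurable_funPT tau).
Qed.

(** The two measures live on two copies of the measurable space of the reals, which
    differ by their display; the identity map transports one to the other. *)
Lemma ge0_integral_dF (D : set R) (f : R -> \bar R) :
  measurable D -> measurable_fun D f -> (forall r, 0 <= f r) ->
  \int[dF tau]_(r in D) f r = \int[distribution P tau]_(r in D) f r.
Proof.
move=> mD mf f0.
pose idR : R -> measurableTypeR R := idfun.
have mid : measurable_fun setT idR by exact: measurable_id.
pose m0 : {measure set (measurableTypeR R) -> \bar R} := pushforward (distribution P tau) idR.
transitivity (\int[m0 mid]_(r in (D : set (measurableTypeR R))) f r).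
  by apply: eq_measure_integral => A mA _; exact: dF_distribution.
by apply: (ge0_integral_pushforward mid (distribution P tau) mD mf) => r _; exact: f0.
Qed.

End distribution.

Section cond_exp.
Context {d} {T : measurableType d} {R : realType} (P : probability T R).
Local Open Scope ereal_scope.

(** Versions of a conditional expectation can be identified separately on the pieces
    of a partition by events of [G]: this is uniqueness of densities for the
    restriction of [P] to [G], localised on [S]. *)
Lemma cond_exp_ae_on (G : set_system T) (X Z V : T -> R) (S : set T) :
  sigma_algebra setT G -> G `<=` measurable -> is_cond_exp P G X Z ->
  G S -> sigma_of V `<=` G ->
  (forall A, G A -> A `<=` S -> \int[P]_(w in A) (V w)%:E = \int[P]_(w in A) (X w)%:E) ->
  {ae P, forall w, S w -> Z w = V w}.
Proof.
move=> sG Gm [mZ iZ eZ] GS mV eV.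
have GE := sigma_algebra_id sG.
pose idG : T -> g_sigma_algebraType G := idfun.
have mid : measurable_fun setT idG.
  by move=> _ B; rewrite /measurable/= GE => GB; rewrite setTI; exact: Gm.
pose mm := isMeasurableFun.Build _ _ _ _ idG mid.
pose idM : {mfun T >-> g_sigma_algebraType G} := HB.pack idG mm.
pose Q : probability _ R := distribution P idM.
have mS : measurable (S : set (g_sigma_algebraType G)) by rewrite /measurable/= GE.
have mVG : measurable_fun (setT : set (g_sigma_algebraType G)) V.
  exact/(sigma_of_measurableP _ _ sG).
have mZG : measurable_fun (setT : set (g_sigma_algebraType G)) Z.
  by move=> _ B mB; rewrite setTI /measurable/= GE; exact: mZ.
have QP (f : T -> R) A : G A ->
    measurable_fun (setT : set (g_sigma_algebraType G)) f ->
    \int[Q]_(w in A) (f w)%:E = \int[P]_(w in A) (f w)%:E.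
  move=> GA mf.
  have mA : measurable (A : set (g_sigma_algebraType G)) by rewrite /measurable/= GE.
  have mfE : measurable_fun (setT : set (g_sigma_algebraType G)) (EFin \o f).
    exact/measurable_EFinP.
  rewrite integralE [RHS]integralE; congr (_ - _).
    apply: (ge0_integral_pushforward mid P mA) => //.
    by apply: measurable_funTS; exact: measurable_funepos.
  apply: (ge0_integral_pushforward mid P mA) => //.
  by apply: measurable_funTS; exact: measurable_funeneg.
have : ae_eq Q S (EFin \o Z) (EFin \o V).
  apply: integral_ae_eq => //.
  - apply: (integrableS measurableT) => //.
    apply/integrableP; split; first exact/measurable_EFinP.
    have mZn : measurable_fun (setT : set (g_sigma_algebraType G)) (fun w => `|Z w|%R).
      exact: measurableT_comp.
    rewrite [X in X < _](_ : _ = \int[Q]_w (`|Z w|%R)%:E)//.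
    rewrite QP//; last exact: sigma_algebraT.
    by have /integrableP[] := iZ.
  - by apply: measurable_funTS; exact/measurable_EFinP.
  - move=> E ES; rewrite /measurable/= GE => GEE.
    by rewrite [LHS](QP Z)// [RHS](QP V)// eV// eZ.
move=> [N [mN QN NE]].
exists N; split; [|exact: QN|].
  by move: mN; rewrite /measurable/= GE; exact: Gm.
move=> w /= nw; apply: NE => /= h; apply: nw => /h; exact: EFin_inj.
Qed.

End cond_exp.

(** * The law of [beta t] before time [tau] *)

Section density_of_beta.
Context {d} {T : measurableType d} {R : realType} (P : probability T R).
Variables (W : R -> T -> R) (hW : standard_brownian_motion P W).
Variable tau : {RV P >-> R}.
Hypothesis hind : indep P (sigma_of tau) (sigma_process `[0, +oo[ W).
Variables (t u : R) (t0 : 0 < t) (tu : t < u).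
Local Open Scope ereal_scope.
Local Notation bridge_past t := (sigma_process `[0%R, t] (bridge W t)).
Local Notation mu := (@lebesgue_measure R).
Local Notation beta := (information_process W tau).
Local Notation S := [set w | (t < tau w)%R].

Lemma measurable_survival : measurable S.
Proof.
have := measurable_funPT tau measurableT _ (measurable_itv `]t, +oo[).
by rewrite setTI (_ : _ @^-1` _ = S)//; apply/seteqP; split => w /=; rewrite in_itv/= andbT.
Qed.

Let mS := measurable_survival.

(** The density of [beta t] on [{t < tau}]. *)
Definition survival_density (x : R) : \bar R :=
  \int[distribution P tau]_(r in `]t, +oo[) (varphi t r x)%:E.

Local Notation one := (fun _ : R * R => 1%R : R).

Lemma cond_mean1 r x : (t < r)%R -> cond_mean t u one r x = 1.
Proof.
move=> tr; rewrite /cond_mean; case: ifPn => //; rewrite -ltNge => ur.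
have v0 : (0 < (r - u) / (r - t) * (u - t))%R.
  by rewrite mulr_gt0 ?divr_gt0// subr_gt0.
under eq_integral do rewrite mul1r gaussE//.
exact: integral_normal_pdf.
Qed.

Lemma joint_mean1 x : joint_mean P tau t u one x = survival_density x.
Proof.
apply: eq_integral => r; rewrite inE/= in_itv/= andbT => tr.
by rewrite cond_mean1// mul1e.
Qed.

Lemma measurable_survival_density : measurable_fun setT survival_density.
Proof.
rewrite (_ : survival_density = joint_mean P tau t u one).
  by apply: measurable_joint_mean => //.
by apply/funext => x; rewrite joint_mean1.
Qed.

Lemma survival_density_ge0 x : 0 <= survival_density x.
Proof. by apply: integral_ge0 => r _; rewrite lee_fin varphi_ge0. Qed.

Lemma integral_survival_density (C : set T) (k : R -> \bar R) :
  bridge_past t C -> measurable_fun setT k -> (forall x, 0 <= k x) ->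
  \int[P]_(w in C `&` S) k (beta t w) = P C * \int[mu]_x (k x * survival_density x).
Proof.
move=> BC mk k0.
have one0 (z : R * R) : (0 <= one z)%R by [].
have mone : measurable_fun setT one by exact: measurable_cst.
have := integral_joint_mean P W hW tau hind t u t0 tu one mone one0 C k BC mk k0.
under eq_integral do rewrite mule1.
by under [X in _ = _ * X -> _]eq_integral do rewrite joint_mean1.
Qed.

Lemma bridge_pastT : bridge_past t setT.
Proof. exact: sigma_algebraT (sigma_process_algebra _ _). Qed.

(** On [{t < tau}] the law of [beta t] has a density, so Lebesgue-null sets of values
    are not charged. *)
Lemma survival_beta_ae (Q : R -> Prop) : {ae mu, forall x, Q x} ->
  {ae P, forall w, S w -> Q (beta t w)}.
Proof.
move=> [N [mN N0 QN]].
have mb : measurable_fun setT (beta t) := measurable_info P W hW tau t t0.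
have mbN : measurable (beta t @^-1` N) by rewrite -[X in measurable X]setTI; exact: mb.
exists (S `&` beta t @^-1` N); split.
- exact: measurableI.
- have m1 : measurable_fun setT (fun x : R => (\1_N x : R)%:E).
    by apply/measurable_EFinP; exact: measurable_indic.
  have k0 (x : R) : 0 <= (\1_N x : R)%:E by rewrite lee_fin.
  have E := integral_survival_density setT _ bridge_pastT m1 k0.
  transitivity (\int[P]_(w in setT `&` S) (\1_N (beta t w))%:E).
    have -> : (fun w => (\1_N (beta t w))%:E) = EFin \o \1_(beta t @^-1` N) :> (T -> \bar R) by [].
    by rewrite integral_indic ?setTI// setIC.
  rewrite E; transitivity (P setT * \int[mu]_(x in N) survival_density x).
    congr (_ * _); rewrite [RHS]integral_mkcond; apply: eq_integral => x _.
    by rewrite patchE indicE; case: (x \in N); rewrite ?mul1e ?mul0e.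
  rewrite null_set_integral ?mule0//.
  exact: measurable_funTS measurable_survival_density.
- move=> w /= /not_implyP[Sw nQ]; split => //.
  by apply: QN => /= h; apply: nQ.
Qed.

(** Hence [{beta t = 0}] and [{tau <= t}] agree almost surely, as [beta t] vanishes on
    the latter. *)
Lemma survival_beta_neq0 : {ae P, forall w, S w -> beta t w <> 0%R}.
Proof.
apply: (survival_beta_ae (fun x => x <> 0%R)).
exists [set 0%R]; split; [exact: measurable_set1|exact: lebesgue_measure_set1|].
by move=> x /= /contrapT.
Qed.

End density_of_beta.

Section nonnegative_prediction.
Context {d} {T : measurableType d} {R : realType} (P : probability T R).
Variables (W : R -> T -> R) (hW : standard_brownian_motion P W).
Variable tau : {RV P >-> R}.
Hypothesis hind : indep P (sigma_of tau) (sigma_process `[0, +oo[ W).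
Variables (t u : R) (t0 : 0 < t) (tu : t < u).
Variables (g : R * R -> R) (mg : measurable_fun setT g) (g0 : forall z, 0 <= g z).
Local Open Scope ereal_scope.
Local Notation bridge_past t := (sigma_process `[0%R, t] (bridge W t)).
Local Notation mu := (@lebesgue_measure R).
Local Notation beta := (information_process W tau).
Local Notation S := [set w | (t < tau w)%R].
Local Notation J := (joint_mean P tau t u g).
Local Notation q := (survival_density P tau t).
Hypothesis gfin : \int[P]_(w in S) (g (tau w, beta u w))%:E < +oo.

Let mS := measurable_survival P tau t.

Let intJ (C : set T) (k : R -> \bar R) := integral_joint_mean P W hW tau hind t u t0 tu g mg g0 C k.
Let intq (C : set T) (k : R -> \bar R) := integral_survival_density P W hW tau hind t u t0 tu C k.
Let mJ : measurable_fun setT J := measurable_joint_mean P tau t u t0 g mg g0.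
Let mq : measurable_fun setT q := measurable_survival_density P tau t u t0 tu.
Let J0 x : 0 <= J x := joint_mean_ge0 P tau t u g g0 x.
Let q0 x : 0 <= q x := survival_density_ge0 P tau t x.

(** Bayes' formula for the conditional mean of [g (tau, beta u)] given
    [beta t = x] and [t < tau]. *)
Definition predictor (x : R) : R := (fine (J x) / fine (q x))%R.

Lemma measurable_predictor : measurable_fun setT predictor.
Proof.
apply: measurable_funM; first exact: (measurableT_comp _ mJ).
by apply: measurable_fun_inv; exact: (measurableT_comp _ mq).
Qed.

Lemma predictor_ge0 x : (0 <= predictor x)%R.
Proof. by rewrite divr_ge0// fine_ge0. Qed.

Let lty_ae (f : R -> \bar R) : measurable_fun setT f -> (forall x, 0 <= f x) ->
  \int[mu]_x f x < +oo -> {ae mu, forall x, f x < +oo}.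
Proof.
move=> mf f0 ff.
have fi : mu.-integrable setT f.
  apply/integrableP; split => //.
  by under eq_integral do rewrite gee0_abs//.
have := integrable_ae measurableT fi.
apply: (@filterS _ _ (ae_filter_ringOfSetsType mu)) => x /(_ Logic.I).
by rewrite ge0_fin_numE.
Qed.

Lemma joint_mean_lty : {ae mu, forall x, J x < +oo}.
Proof.
apply: lty_ae => //.
have := intJ setT (cst 1) (bridge_pastT W t) (measurable_cst _) (fun=> lee01).
rewrite setTI probability_setT mul1e.
under eq_integral do rewrite mul1e.
under [X in _ = X -> _]eq_integral do rewrite mul1e.
by move=> <-.
Qed.

Lemma survival_density_lty : {ae mu, forall x, q x < +oo}.
Proof.
apply: lty_ae => //.
have := intq setT (cst 1) (bridge_pastT W t) (measurable_cst _) (fun=> lee01).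
rewrite setTI probability_setT mul1e.
under [X in _ = X -> _]eq_integral do rewrite mul1e.
move=> <-; rewrite integral_cst// mul1e.
by rewrite (le_lt_trans (probability_le1 P mS))// ltry.
Qed.

(** The Gaussian densities are positive, so a vanishing mixture means that [tau] never
    exceeds [t]. *)
Lemma survival_density_eq0 x : q x = 0 -> J x = 0.
Proof.
move=> qx0.
have mx : measurable_fun setT (fun r : R => (r, x)) by exact: measurable_fun_pair.
have mphi : measurable_fun setT (fun r => (varphi t r x)%:E).
  by apply/measurable_EFinP; exact: (measurableT_comp (measurable_varphi t t0) mx).
have mD : measurable (`]t, +oo[%classic : set R) by exact: measurable_itv.
have D0 : distribution P tau `]t, +oo[ = 0.
  have : \int[distribution P tau]_(r in `]t, +oo[) `|(varphi t r x)%:E| = 0.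
    rewrite -[RHS]qx0; apply: eq_integral => r _.
    by rewrite gee0_abs// lee_fin varphi_ge0.
  move=> /(ae_eq_integral_abs (distribution P tau) mD (measurable_funTS mphi)).
  move=> [N [mN N0 DN]]; apply: (subset_measure0 mD mN _ N0) => r Dr.
  apply: DN => /= /(_ Dr) /eqP; rewrite eqe gt_eqF//.
  move: Dr; rewrite /= in_itv/= andbT => tr.
  rewrite /varphi t0 tr/= /gauss mulr_gt0 ?expR_gt0// invr_gt0 sqrtr_gt0.
  have r0 : (0 < r)%R by exact: lt_trans tr.
  by apply: mulr_gt0; [rewrite mulr_gt0 ?pi_gt0|rewrite divr_gt0 ?mulr_gt0 ?subr_gt0].
rewrite /joint_mean null_set_integral//; apply: measurable_funTS.
apply: emeasurable_funM => //.
exact: (measurableT_comp (measurable_cond_mean t u g mg g0) mx).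
Qed.

Lemma predictor_density : {ae mu, forall x, (predictor x)%:E * q x = J x}.
Proof.
have := survival_density_lty; have := joint_mean_lty.
apply: (@filterS2 _ _ (ae_filter_ringOfSetsType mu)) => x Jf qf.
have [qx0|qx0] := eqVneq (q x) 0.
  by rewrite qx0 mule0 survival_density_eq0.
rewrite /predictor -[X in _ * X]fineK ?ge0_fin_numE// -EFinM divfK ?fineK ?ge0_fin_numE//.
by rewrite fine_eq0// ge0_fin_numE.
Qed.

(** Both sides equal [P C] times the Lebesgue integral of [k] times [joint_mean], the
    left one because [predictor] times [survival_density] is [joint_mean]. *)
Lemma integral_predictor (C : set T) (k : R -> \bar R) :
  bridge_past t C -> measurable_fun setT k -> (forall x, 0 <= k x) ->
  \int[P]_(w in C `&` S) (k (beta t w) * (predictor (beta t w))%:E) =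
  \int[P]_(w in C `&` S) (k (beta t w) * (g (tau w, beta u w))%:E).
Proof.
move=> BC mk k0.
have mkp : measurable_fun setT (fun x => k x * (predictor x)%:E).
  by apply: emeasurable_funM => //; apply/measurable_EFinP; exact: measurable_predictor.
have kp0 x : 0 <= k x * (predictor x)%:E by rewrite mule_ge0// lee_fin predictor_ge0.
rewrite intJ//; etransitivity; first exact: (intq C _ BC mkp kp0).
congr (_ * _); apply: ge0_ae_eq_integral => //.
- exact: emeasurable_funM.
- exact: emeasurable_funM.
- by move=> x _; rewrite mule_ge0.
- by move=> x _; rewrite mule_ge0.
have := predictor_density.
apply: (@filterS _ _ (ae_filter_ringOfSetsType mu)) => x px _.
by rewrite -muleA px.
Qed.

End nonnegative_prediction.

(** * The events known at time [t] *)

Section filtration.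
Context {d} {T : measurableType d} {R : realType} (P : probability T R).
Hypothesis hP : measure_is_complete P.
Variables (W : R -> T -> R) (hW : standard_brownian_motion P W).
Variable tau : {RV P >-> R}.
Hypothesis htau : forall w, 0 < tau w.
Hypothesis hind : indep P (sigma_of tau) (sigma_process `[0, +oo[ W).
Variables (t : R) (t0 : 0 < t).
Local Notation beta := (information_process W tau).
Local Notation S := [set w | t < tau w].
Local Notation Ft := (completed_filtration P beta t).
Local Notation bridge_past t := (sigma_process `[0, t] (bridge W t)).

Lemma completed_algebra : sigma_algebra setT Ft.
Proof. exact: smallest_sigma_algebra. Qed.

Lemma sigma_of_beta s : 0 <= s <= t -> sigma_of (beta s) `<=` Ft.
Proof.
move=> st A sA; apply: sub_sigma_algebra; left.
by apply: (sigma_of_process `[0, t]%classic beta s) => //=; rewrite in_itv.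
Qed.

Lemma completed_negligible N : P.-negligible N -> Ft N.
Proof. by move=> nN; apply: sub_sigma_algebra; right. Qed.

Lemma measurable_beta s : 0 <= s -> measurable_fun setT (beta s).
Proof.
rewrite le_eqVlt => /predU1P[<-|s0]; last exact: measurable_info hW _ _ s0.
rewrite (_ : beta 0 = cst 0); first exact: measurable_cst.
by apply/funext => w; rewrite /information_process (bm_start hW) mul0r mul0r subrr.
Qed.

Lemma completed_measurable : Ft `<=` measurable.
Proof.
apply: smallest_sub; first exact: sigma_algebra_measurable.
move=> A [|]; last exact: hP.
move: A; apply: sigma_process_sub; first exact: sigma_algebra_measurable.
move=> s /=; rewrite in_itv/= => /andP[s0 _].
by apply: sigma_of_sub; exact: measurable_beta.
Qed.

Lemma completed_ae (A B : set T) : Ft A -> {ae P, forall w, A w <-> B w} -> Ft B.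
Proof.
move=> FA [N [mN N0 AB]].
have nN M : M `<=` N -> Ft M by move=> MN; apply: completed_negligible; exists N; split.
have FAN : Ft (A `&` ~` N).
  apply: (sigma_algebraI _ _ _ completed_algebra) => //.
  have [_ FC _] := completed_algebra; rewrite -setTD; apply: FC.
  exact: nN.
have -> : B = (A `&` ~` N) `|` (B `&` N).
  apply/seteqP; split => [w Bw|w [[Aw nNw]|[]//]].
    have [Nw|nNw] := pselect (N w); [by right|left; split => //].
    by apply: contrapT => nA; apply: nNw; apply: AB => /= -[_ /(_ Bw)].
  by apply: contrapT => nB; apply: nNw; apply: AB => /= -[/(_ Aw)].
have [F0 _ FU] := completed_algebra.
rewrite -bigcup2E; apply: FU => -[|[|n]]/=; [exact: FAN| |exact: F0].
by apply: nN => w [].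
Qed.

(** [beta] vanishes from time [tau] on, and almost surely not before. *)
Lemma completed_tau_le s : s <= t -> Ft [set w | tau w <= s].
Proof.
move=> st; have [s0|s0] := leP s 0.
  rewrite (_ : [set _ | _] = set0); first by have [] := completed_algebra.
  by apply/seteqP; split => // w /= /le_trans/(_ s0); rewrite leNgt htau.
apply: (completed_ae (beta s @^-1` [set 0])).
  by apply: (sigma_of_beta s); [rewrite ltW|exact: sigma_of_pre].
have s1 : s < s + 1 by rewrite ltrDl.
apply: filterS (survival_beta_neq0 P W hW tau hind s (s + 1) s0 s1) => w /= h.
split => [b0|ts]; last exact: info_after.
by rewrite leNgt; apply/negP => /h.
Qed.

Lemma completed_survival : Ft S.
Proof.
have [_ FC _] := completed_algebra.
rewrite (_ : S = setT `\` [set w | tau w <= t]).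
  by apply: FC; exact: completed_tau_le.
rewrite setTD; apply/seteqP; split => w /=; first by rewrite ltNge => /negP.
by move=> /negP; rewrite -ltNge.
Qed.

(** So every function of [tau] is known at time [t] on [{tau <= t}]. *)
Lemma completed_tau_min : sigma_of (fun w => Num.min (tau w) t) `<=` Ft.
Proof.
apply/sigma_of_measurableP; first exact: completed_algebra.
have [F0 FC FU] := completed_algebra.
have Fle s : Ft [set w | Num.min (tau w) t <= s].
  have [ts|st] := leP t s.
    rewrite (_ : [set _ | _] = setT); first exact: sigma_algebraT completed_algebra.
    by apply/seteqP; split => // w _ /=; rewrite ge_min ts orbT.
  rewrite (_ : [set _ | _] = [set w | tau w <= s]); first by apply: completed_tau_le; exact: ltW.
  by apply/seteqP; split => w /=; rewrite ge_min (leNgt t) st orbF.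
apply: (measurability R.-ocitv.-measurable) => // _ [_ [[a b] _ <-] <-].
rewrite /measurable/= (sigma_algebra_id completed_algebra).
rewrite (_ : setT `&` _ = [set w | Num.min (tau w) t <= b] `&`
   (setT `\` [set w | Num.min (tau w) t <= a])).
  by apply: (sigma_algebraI _ _ _ completed_algebra) => //; exact: FC.
rewrite setTI setTD; apply/seteqP; split => w /=; rewrite in_itv/=.
  by move=> /andP[aw wb]; split => //; apply/negP; rewrite -ltNge.
by move=> [wb /negP]; rewrite -ltNge wb => ->.
Qed.

(** The events before [t] are generated, on [{t < tau}] and up to null sets, by
    the bridge of length [t] and the value of [beta] at time [t]. *)
Definition cylinder : set_system T :=
  [set A | exists C B, [/\ bridge_past t C, measurable B & A = C `&` beta t @^-1` B]].

(** The sets with this property form a sigma-algebra. It contains the null sets, and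
    the events of [beta s] for [s <= t] since [beta s] is, on [{t < tau}], the bridge of
    length [t] at [s] plus [s / t] times [beta t]. *)
Lemma completed_cylinder (A : set T) : Ft A ->
  exists2 A', <<s cylinder >> A' & {ae P, forall w, S w -> (A w <-> A' w)}.
Proof.
pose D := [set A | exists2 A', <<s cylinder >> A' &
  {ae P, forall w, S w -> (A w <-> A' w)}].
suff : Ft `<=` D by apply.
have scyl := smallest_sigma_algebra setT cylinder.
have [cyl0 cylC cylU] := scyl.
have sD : sigma_algebra setT D.
  split.
  - by exists set0 => //; exact: aeW.
  - move=> {}A [A' cA' AA']; exists (setT `\` A'); first exact: cylC.
    apply: filterS AA' => w h Sw; rewrite !setTD; have [h1 h2] := h Sw.
    by split => /= nA; apply: contra_not nA.
  - move=> F DF.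
    have /choice[F' F'E] : forall n, exists A', <<s cylinder >> A' /\
        {ae P, forall w, S w -> (F n w <-> A' w)}.
      by move=> n; have [A' cA' hA'] := DF n; exists A'.
    exists (\bigcup_n F' n); first by apply: cylU => n; exact: (F'E n).1.
    have /ae_foralln : forall n, {ae P, forall w, S w -> (F n w <-> F' n w)}.
      by move=> n; exact: (F'E n).2.
    apply: filterS => w h Sw; split => -[n _ Fn]; exists n => //; exact/(h n Sw).
have betacyl : sigma_of (beta t) `<=` <<s cylinder >>.
  move=> _ [B mB <-]; apply: sub_sigma_algebra; exists setT, B; split => //.
  exact: bridge_pastT.
have bridgecyl s : 0 <= s <= t -> sigma_of (bridge W t s) `<=` <<s cylinder >>.
  move=> st {}A sA; apply: sub_sigma_algebra; exists A, setT; split => //.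
    by apply: (sigma_of_process `[0, t]%classic _ s) => //=; rewrite in_itv.
  by rewrite preimage_setT setIT.
apply: smallest_sub => // {}A [|nA]; last first.
  exists set0 => //; case: nA => N [mN N0 AN]; exists N; split => // w /=.
  by move=> /not_implyP[_ nA]; apply: AN; apply: contrapT => nAw; apply: nA.
move: A; apply: sigma_process_sub => // s /=; rewrite in_itv/= => st _ [B mB <-].
rewrite setTI.
pose b w := 1 * bridge W t s w + (s / t) * beta t w.
exists (b @^-1` B).
  suff : sigma_of b `<=` <<s cylinder >> by apply; exact: sigma_of_pre.
  by apply: sigma_of_affine => //; exact: bridgecyl.
apply: aeW => w /= Sw; have -> // : beta s w = b w.
have /andP[s0 st'] := st; have tw := htau w.
rewrite /b /bridge /information_process !max_l ?(ltW Sw) ?(le_trans st' (ltW Sw))//.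
by field; rewrite !gt_eqF.
Qed.

End filtration.

Section conditional.
Context {d} {T : measurableType d} {R : realType} (P : probability T R).
Hypothesis hP : measure_is_complete P.
Variables (W : R -> T -> R) (hW : standard_brownian_motion P W).
Variable tau : {RV P >-> R}.
Hypothesis htau : forall w, 0 < tau w.
Hypothesis hind : indep P (sigma_of tau) (sigma_process `[0, +oo[ W).
Variables (t u : R) (t0 : 0 < t) (tu : t < u).
Variables (g : R * R -> R) (mg : measurable_fun setT g) (g0 : forall z, 0 <= g z).
Local Open Scope ereal_scope.
Local Notation bridge_past t := (sigma_process `[0%R, t] (bridge W t)).
Local Notation beta := (information_process W tau).
Local Notation S := [set w | (t < tau w)%R].
Local Notation Ft := (completed_filtration P beta t).
Local Notation h := (predictor P tau t u g).
Local Notation cyl := (cylinder P W tau t).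
Hypothesis gfin : \int[P]_(w in S) (g (tau w, beta u w))%:E < +oo.

Let mS := measurable_survival P tau t.
Let mbt : measurable_fun setT (beta t) := measurable_info P W hW tau t t0.
Let mX : measurable_fun setT (fun w => g (tau w, beta u w)).
Proof.
apply: measurableT_comp => //; apply: measurable_fun_pair => //.
by apply: (measurable_info P W hW); exact: lt_trans tu.
Qed.
Let mh : measurable_fun setT (fun w => h (beta t w)).
Proof. exact: (measurableT_comp (measurable_predictor P tau t u t0 tu g mg g0) mbt). Qed.

Let integral_S (V : T -> R) (A : set T) : measurable A ->
  \int[P]_(w in A) (V w * \1_S w)%:E = \int[P]_(w in A `&` S) (V w)%:E.
Proof.
move=> mA; rewrite [RHS]integral_mkcondr; apply: eq_integral => w _.
by rewrite patchE indicE; case: (w \in S); rewrite ?mulr1 ?mulr0.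
Qed.

Let integrable_S (V : T -> R) : measurable_fun setT V -> (forall w, 0 <= V w)%R ->
  \int[P]_(w in S) (V w)%:E < +oo -> P.-integrable setT (fun w => (V w * \1_S w)%:E).
Proof.
move=> mV V0 Vfin; apply/integrableP; split.
  by apply/measurable_EFinP; apply: measurable_funM.
under eq_integral => w _ do rewrite gee0_abs ?lee_fin ?mulr_ge0//.
by rewrite integral_S// setTI.
Qed.

Let cylI : setI_closed cyl.
Proof.
move=> A A' [C [B [BC mB ->]]] [C' [B' [BC' mB' ->]]].
exists (C `&` C'), (B `&` B'); split.
- exact: (sigma_algebraI _ _ _ (sigma_process_algebra _ _) BC BC').
- exact: measurableI.
- by rewrite setIACA preimage_setI.
Qed.

Let cylm : cyl `<=` measurable.
Proof.
move=> A [C [B [BC mB ->]]]; apply: measurableI.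
  exact: (bridge_past_measurable P W hW t _ BC).
by rewrite -[X in measurable X]setTI; exact: mbt.
Qed.

Let integral_cylinder (V : T -> R) (C : set T) (B : set R) :
  \int[P]_(w in C `&` beta t @^-1` B `&` S) (V w)%:E =
  \int[P]_(w in C `&` S) ((\1_B (beta t w))%:E * (V w)%:E).
Proof.
rewrite setIAC integral_mkcondr; apply: eq_integral => w _.
rewrite patchE indicE.
have -> : (w \in beta t @^-1` B) = (beta t w \in B) by apply/idP/idP; rewrite !inE.
by case: (_ \in B); rewrite ?mul1e ?mul0e.
Qed.

Let integral_cyl A : cyl A ->
  \int[P]_(w in A `&` S) (h (beta t w))%:E = \int[P]_(w in A `&` S) (g (tau w, beta u w))%:E.
Proof.
move=> [C [B [BC mB ->]]]; rewrite !integral_cylinder.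
apply: (integral_predictor P W hW tau hind t u t0 tu g mg g0 gfin C (fun x => (\1_B x)%:E)) => //.
  by apply/measurable_EFinP; exact: measurable_indic.
Qed.

Let cylT : cyl setT.
Proof.
by exists setT, setT; split => //; [exact: bridge_pastT|rewrite preimage_setT setIT].
Qed.

Lemma predictor_fin : \int[P]_(w in S) (h (beta t w))%:E < +oo.
Proof. by have := integral_cyl _ cylT; rewrite setTI => ->. Qed.

Let integral_agree (V : T -> R) (A A' : set T) : measurable_fun setT V ->
  (forall w, 0 <= V w)%R -> measurable A -> measurable A' -> A `<=` S ->
  {ae P, forall w, S w -> (A w <-> A' w)} ->
  \int[P]_(w in A) (V w)%:E = \int[P]_(w in A' `&` S) (V w)%:E.
Proof.
move=> mV V0 mA mA' AS AA'; rewrite integral_mkcond [RHS]integral_mkcond.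
have mVE : measurable_fun setT (EFin \o V) by exact/measurable_EFinP.
apply: ge0_ae_eq_integral => //.
- by apply/(measurable_restrictT _ mA); exact: measurable_funTS.
- by apply/(measurable_restrictT _ (measurableI _ _ mA' mS)); exact: measurable_funTS.
- by move=> w _; apply: erestrict_ge0 => ? _; rewrite lee_fin.
- by move=> w _; apply: erestrict_ge0 => ? _; rewrite lee_fin.
apply: filterS AA' => w AA' _; rewrite !patchE.
have -> // : (w \in A) = (w \in A' `&` S).
apply/idP/idP; rewrite !inE; [move=> Aw|move=> [A'w Sw]].
  have Sw := AS _ Aw; split => //.
  by have [+ _] := AA' Sw; apply.
by have [_ +] := AA' Sw; apply.
Qed.

(** Up to a null set, on [{t < tau}], the event [A] is generated by cylinders, for
    which [integral_predictor] applies with the indicator of the value of [beta t]. *)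
Lemma integral_predictor_past (A : set T) : Ft A -> A `<=` S ->
  \int[P]_(w in A) (h (beta t w))%:E = \int[P]_(w in A) (g (tau w, beta u w))%:E.
Proof.
move=> FA AS.
have [A' cA' AA'] := completed_cylinder P W tau htau t t0 A FA.
have mA : measurable A by exact: (completed_measurable P hP W hW tau t _ FA).
have mA' : measurable A' by apply: (smallest_sub _ cylm cA'); exact: sigma_algebra_measurable.
rewrite (integral_agree _ A A')//; last by move=> w; exact: predictor_ge0.
rewrite [RHS](integral_agree _ A A')// -!integral_S//.
apply: (eq_integral_g_sigma_algebra P cyl) => //.
- by apply: integrable_S => //; [move=> w; exact: predictor_ge0|exact: predictor_fin].
- exact: integrable_S.
- by rewrite !integral_S//; exact: integral_cyl.
- by move=> B cB; rewrite !integral_S ?cylm//; [exact: integral_cyl|exact: cylm|exact: cylm].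
Qed.

End conditional.

(** * The explicit formula *)

Section prediction_formula.
Context {d} {T : measurableType d} {R : realType} (P : probability T R).
Variable tau : {RV P >-> R}.
Variables (t u : R) (t0 : 0 < t) (tu : t < u).
Variables (g : R * R -> R) (mg : measurable_fun setT g).
Local Notation mu := (@lebesgue_measure R).
Local Notation nu := (dF tau).

(** The terms of [prediction] that live on [{t < tau}], as a function of [x = beta t]. *)
Definition prediction_after (x : R) : R :=
  \int[nu]_(r in `]t, u]) (g (r, 0) * phi tau t r x) +
  \int[nu]_(r in `]u, +oo[)
    ((\int[mu]_y (g (r, y) * gauss ((r - u) / (r - t) * (u - t)) y
                                   ((r - u) / (r - t) * x)))
     * phi tau t r x).

Let gp := g^\+.
Let gn := g^\-.
Let mgp : measurable_fun setT gp. Proof. exact: measurable_funrpos. Qed.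
Let mgn : measurable_fun setT gn. Proof. exact: measurable_funrneg. Qed.
Let gp0 z : 0 <= gp z. Proof. exact: funrpos_ge0. Qed.
Let gn0 z : 0 <= gn z. Proof. exact: funrneg_ge0. Qed.

Variable x : R.
Hypothesis Jp : (joint_mean P tau t u gp x < +oo)%E.
Hypothesis Jn : (joint_mean P tau t u gn x < +oo)%E.

Let Kp r := cond_mean t u gp r x.
Let Kn r := cond_mean t u gn r x.
Let k r : R := if r <= u then g (r, 0) else
  \int[mu]_y (g (r, y) * gauss ((r - u) / (r - t) * (u - t)) y
                               ((r - u) / (r - t) * x)).
Let v r := varphi t r x.

Let kE r : k r = fine (Kp r - Kn r)%E.
Proof.
rewrite /k /Kp /Kn /cond_mean; case: ifP => _.
  exact: (esym (congr1 (fun f => f (r, 0)) (funrposBneg g))).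
rewrite /Rintegral integralE; congr (fine (_ - _)%E); apply: eq_integral => y _.
  by rewrite funeposE /gp /funrpos -EFin_max maxr_pMl ?gauss_ge0// mul0r.
by rewrite funenegE /gn /funrneg -EFinN -EFin_max maxr_pMl ?gauss_ge0// mul0r mulNr.
Qed.

Let v0 r : 0 <= v r. Proof. exact: varphi_ge0. Qed.

Let Kp0 r : (0 <= Kp r)%E. Proof. exact: cond_mean_ge0. Qed.
Let Kn0 r : (0 <= Kn r)%E. Proof. exact: cond_mean_ge0. Qed.

Let mpairx : measurable_fun setT (fun r : R => (r, x)).
Proof. exact: measurable_fun_pair. Qed.

Let mKp : measurable_fun setT Kp.
Proof. exact: (measurableT_comp (measurable_cond_mean t u gp mgp gp0) mpairx). Qed.

Let mKn : measurable_fun setT Kn.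
Proof. exact: (measurableT_comp (measurable_cond_mean t u gn mgn gn0) mpairx). Qed.

Let mv : measurable_fun setT v.
Proof. exact: (measurableT_comp (measurable_varphi t t0) mpairx). Qed.

Let D : set R := `]t, +oo[%classic.
Let mD : measurable D. Proof. exact: measurable_itv. Qed.
Let mDF : @measurable _ (measurableTypeR R) D := mD.

Let integrable_K (K : R -> \bar R) : measurable_fun setT K -> (forall r, 0 <= K r)%E ->
  (\int[distribution P tau]_(r in D) (K r * (v r)%:E) < +oo)%E ->
  nu.-integrable D (fun r => K r * (v r)%:E)%E.
Proof.
move=> mK K0 Kfin.
have mKv : measurable_fun setT (fun r => K r * (v r)%:E)%E.
  by apply: emeasurable_funM => //; exact/measurable_EFinP.
apply/integrableP; split; first exact: measurable_funTS.
have Kv0 r : (0 <= K r * (v r)%:E)%E by rewrite mule_ge0// lee_fin.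
under eq_integral => r _ do rewrite gee0_abs ?Kv0//.
by rewrite (ge0_integral_dF P tau D _ mD (measurable_funTS mKv)).
Qed.

Let iKp : nu.-integrable D (fun r => Kp r * (v r)%:E)%E := integrable_K Kp mKp Kp0 Jp.
Let iKn : nu.-integrable D (fun r => Kn r * (v r)%:E)%E := integrable_K Kn mKn Kn0 Jn.

Let F r := k r * v r.

Let mF : measurable_fun setT F.
Proof.
apply: measurable_funM => //.
rewrite (_ : k = fun r => fine (Kp r - Kn r)%E); last by apply/funext => r; exact: kE.
by apply: (measurableT_comp _ (emeasurable_funB mKp mKn)).
Qed.

Let vgt0 r : D r -> 0 < v r.
Proof.
rewrite /D /= in_itv/= andbT => tr; have r0 : 0 < r by exact: lt_trans tr.
rewrite /v /varphi t0 tr/= /gauss mulr_gt0 ?expR_gt0// invr_gt0 sqrtr_gt0.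
by apply: mulr_gt0; [rewrite mulr_gt0 ?pi_gt0|rewrite divr_gt0 ?mulr_gt0 ?subr_gt0].
Qed.

Let FE : ae_eq nu D (EFin \o F)
  ((fun r => Kp r * (v r)%:E) \- (fun r => Kn r * (v r)%:E))%E.
Proof.
have := integrable_ae mDF iKn; have := integrable_ae mDF iKp.
apply: (@filterS2 _ _ (ae_filter_ringOfSetsType nu)) => r fp fn Dr.
have vr := vgt0 r Dr.
have fin_K K : (0 <= K)%E -> (K * (v r)%:E)%E \is a fin_num -> K \is a fin_num.
  by case: K => [//|_|//]; rewrite gt0_mulye ?lte_fin.
have Kpf := fin_K _ (Kp0 r) (fp Dr); have Knf := fin_K _ (Kn0 r) (fn Dr).
by rewrite /= /F kE EFinM fineK ?fin_numB ?Kpf// muleBl// fin_num_adde_defl// fin_numN.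
Qed.

Let iF : nu.-integrable D (EFin \o F).
Proof.
apply: (le_integrable mDF _ _ (integrableD mDF iKp iKn)).
  by apply: measurable_funTS; exact/measurable_EFinP.
move=> r Dr; rewrite /= /F kE [X in (_ <= X)%E]gee0_abs; last first.
  by rewrite adde_ge0// mule_ge0// lee_fin.
rewrite -muleDl// ?ge0_adde_def ?inE// /= normrM EFinM (ger0_norm (v0 r)).
rewrite lee_wpmul2r ?lee_fin//.
have := Kp0 r; have := Kn0 r.
move: (Kp r) (Kn r) => [a| |] [b| |]//=; rewrite ?lee_fin ?normr0 ?leey//.
by move=> b0 a0; rewrite (le_trans (ler_normB _ _))// !ger0_norm.
Qed.

Let Rintegral_F : \int[nu]_(r in D) F r =
  fine (joint_mean P tau t u gp x) - fine (joint_mean P tau t u gn x).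
Proof.
have mKv K : measurable_fun setT K -> measurable_fun D (fun r => K r * (v r)%:E)%E.
  by move=> mK; apply: measurable_funTS; apply: emeasurable_funM => //; exact/measurable_EFinP.
have Kv0 (K : R -> \bar R) : (forall r, 0 <= K r)%E -> forall r, (0 <= K r * (v r)%:E)%E.
  by move=> K0 r; rewrite mule_ge0// lee_fin.
rewrite /Rintegral.
have -> : (\int[nu]_(r in D) (F r)%:E = \int[nu]_(r in D)
    ((fun r => Kp r * (v r)%:E) \- (fun r => Kn r * (v r)%:E)) r)%E.
  apply: (ae_eq_integral _ _ mDF _ _ FE).
    by apply: measurable_funTS; exact/measurable_EFinP.
  by apply: emeasurable_funB; exact: mKv.
rewrite integralB// fineB ?integrable_fin_num//.
rewrite (ge0_integral_dF P tau D _ mD (mKv _ mKp) (Kv0 _ Kp0)).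
by rewrite (ge0_integral_dF P tau D _ mD (mKv _ mKn) (Kv0 _ Kn0)).
Qed.

(** Both integrals over the lengths have the integrand [F] below, up to the
    normalisation. The conditional means of [g^\+] and [g^\-] may be infinite for some
    lengths, but these form a null set as soon as their averages are finite; elsewhere
    the means can be subtracted. *)
Lemma prediction_afterE :
  prediction_after x = predictor P tau t u gp x - predictor P tau t u gn x.
Proof.
rewrite /predictor -mulrBl -Rintegral_F.
pose Q := fine (survival_density P tau t x).
have phiE r : phi tau t r x = v r / Q.
  rewrite /phi; congr (_ / fine _).
  apply: (ge0_integral_dF P tau D (fun r => (v r)%:E) mD); last by move=> ?; rewrite lee_fin.
  by apply: measurable_funTS; exact/measurable_EFinP.
have D1 : `]t, u]%classic `<=` D.
  by apply: subset_itvl.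
have D2 : `]u, +oo[%classic `<=` D.
  by apply: subset_itvr; rewrite bnd_simp ltW.
have i1 : nu.-integrable `]t, u] (EFin \o F) by apply: integrableS iF.
have i2 : nu.-integrable `]u, +oo[ (EFin \o F) by apply: integrableS iF.
have -> : \int[nu]_(r in D) F r = \int[nu]_(r in `]t, u]) F r + \int[nu]_(r in `]u, +oo[) F r.
  have DU : D = `]t, u]%classic `|` `]u, +oo[%classic.
    by rewrite /D -itv_bndbnd_setU// bnd_simp ltW.
  rewrite DU Rintegral_setU//; first by rewrite -DU.
  apply/disj_setPS => r [] /=; rewrite !in_itv/= andbT => /andP[_ ru].
  by rewrite ltNge ru.
rewrite mulrDl -!RintegralZr//; congr (_ + _); apply: eq_Rintegral => r.
  rewrite inE/= in_itv/= => /andP[_ ru].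
  by rewrite phiE /F /k ru mulrA.
rewrite inE/= in_itv/= andbT => ur.
by rewrite phiE /F /k leNgt ur/= mulrA.
Qed.

End prediction_formula.

(** * Identification of the conditional expectations *)

Section identification.
Context {d} {T : measurableType d} {R : realType} (P : probability T R).
Hypothesis hP : measure_is_complete P.
Variables (W : R -> T -> R) (hW : standard_brownian_motion P W).
Variable tau : {RV P >-> R}.
Hypothesis htau : forall w, 0 < tau w.
Hypothesis hind : indep P (sigma_of tau) (sigma_process `[0, +oo[ W).
Variables (t u : R) (t0 : 0 < t) (tu : t < u).
Variables (g : R * R -> R) (mg : measurable_fun setT g).
Local Notation beta := (information_process W tau).
Local Notation S := [set w | t < tau w].
Local Notation Ft := (completed_filtration P beta t).
Local Notation payoff := (fun w => g (tau w, beta u w)).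
Hypothesis iX : P.-integrable setT (EFin \o payoff).

Let mS := measurable_survival P tau t.
Let u0 : 0 < u. Proof. exact: lt_trans tu. Qed.
Let mbt : measurable_fun setT (beta t) := measurable_info P W hW tau t t0.
Let gp := g^\+.
Let gn := g^\-.
Let mgp : measurable_fun setT gp. Proof. exact: measurable_funrpos. Qed.
Let mgn : measurable_fun setT gn. Proof. exact: measurable_funrneg. Qed.
Let gp0 z : 0 <= gp z. Proof. exact: funrpos_ge0. Qed.
Let gn0 z : 0 <= gn z. Proof. exact: funrneg_ge0. Qed.
Let Xp w := gp (tau w, beta u w).
Let Xn w := gn (tau w, beta u w).

Let iXp : P.-integrable setT (EFin \o Xp).
Proof. by have := integrable_funrpos measurableT iX. Qed.
Let iXn : P.-integrable setT (EFin \o Xn).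
Proof. by have := integrable_funrneg measurableT iX. Qed.

Let fin_S (V : T -> R) : (forall w, 0 <= V w) -> P.-integrable setT (EFin \o V) ->
  (\int[P]_(w in S) (V w)%:E < +oo)%E.
Proof.
move=> V0 iV; have /integrableP[_] := integrableS measurableT mS (@subsetT _ _) iV.
by under eq_integral => w _ do rewrite /= ger0_norm ?V0//.
Qed.

Let gpfin : (\int[P]_(w in S) (gp (tau w, beta u w))%:E < +oo)%E.
Proof. by apply: fin_S iXp => w; exact: gp0. Qed.
Let gnfin : (\int[P]_(w in S) (gn (tau w, beta u w))%:E < +oo)%E.
Proof. by apply: fin_S iXn => w; exact: gn0. Qed.

Let hp := predictor P tau t u gp.
Let hn := predictor P tau t u gn.
Let mhp : measurable_fun setT hp := measurable_predictor P tau t u t0 tu gp mgp gp0.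
Let mhn : measurable_fun setT hn := measurable_predictor P tau t u t0 tu gn mgn gn0.

Let V w := hp (beta t w) - hn (beta t w).

Let sigma_of_V : sigma_of V `<=` sigma_of (beta t).
Proof.
have mh : measurable_fun setT (hp \- hn) := measurable_funB mhp mhn.
move=> _ [B mB <-]; exists ((hp \- hn) @^-1` B) => //.
by rewrite -[X in measurable X]setTI; exact: (mh measurableT B mB).
Qed.

Let integrable_h (h : R -> R) A : measurable A -> A `<=` S ->
  measurable_fun setT h -> (forall x, 0 <= h x) ->
  (\int[P]_(w in S) (h (beta t w))%:E < +oo)%E ->
  P.-integrable A (fun w => (h (beta t w))%:E).
Proof.
move=> mA AS mh h0 hfin; apply: (integrableS mS) => //.
apply/integrableP; split.
  by apply: measurable_funTS; apply/measurable_EFinP; exact: measurableT_comp.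
by under eq_integral => w _ do rewrite /= ger0_norm ?h0//.
Qed.

Let integral_V A : Ft A -> A `<=` S ->
  (\int[P]_(w in A) (V w)%:E = \int[P]_(w in A) (payoff w)%:E)%E.
Proof.
move=> FA AS.
have mA : measurable A by exact: (completed_measurable P hP W hW tau t _ FA).
have ihp : P.-integrable A (fun w => (hp (beta t w))%:E).
  apply: integrable_h => //; first by move=> x; exact: predictor_ge0.
  exact: (predictor_fin P W hW tau hind t u t0 tu gp mgp gp0 gpfin).
have ihn : P.-integrable A (fun w => (hn (beta t w))%:E).
  apply: integrable_h => //; first by move=> x; exact: predictor_ge0.
  exact: (predictor_fin P W hW tau hind t u t0 tu gn mgn gn0 gnfin).
have iA (Y : T -> R) : P.-integrable setT (EFin \o Y) -> P.-integrable A (EFin \o Y).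
  by apply: integrableS.
transitivity (\int[P]_(w in A) (hp (beta t w))%:E - \int[P]_(w in A) (hn (beta t w))%:E)%E.
  exact: (@integralB_EFin _ _ _ P A (fun w => hp (beta t w))
    (fun w => hn (beta t w)) mA ihp ihn).
transitivity (\int[P]_(w in A) (Xp w)%:E - \int[P]_(w in A) (Xn w)%:E)%E.
  congr (_ - _)%E.
    exact: (integral_predictor_past P hP W hW tau htau hind t u t0 tu gp mgp gp0 gpfin A FA AS).
  exact: (integral_predictor_past P hP W hW tau htau hind t u t0 tu gn mgn gn0 gnfin A FA AS).
etransitivity; first exact/esym/(@integralB_EFin _ _ _ P A Xp Xn mA (iA _ iXp) (iA _ iXn)).
apply: eq_integral => w _; congr EFin.
exact: (congr1 (fun f => f (tau w, beta u w)) (funrposBneg g)).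
Qed.

Let prediction_V : {ae P, forall w, S w -> V w = prediction_after P tau t u g (beta t w)}.
Proof.
have := survival_beta_ae P W hW tau hind t u t0 tu _
  (joint_mean_lty P W hW tau hind t u t0 tu gp mgp gp0 gpfin).
have := survival_beta_ae P W hW tau hind t u t0 tu _
  (joint_mean_lty P W hW tau hind t u t0 tu gn mgn gn0 gnfin).
by apply: filterS2 => w Jn Jp Sw; rewrite prediction_afterE//; [exact: Jp|exact: Jn].
Qed.

Lemma cond_exp_past_survival Z : is_cond_exp P Ft payoff Z ->
  {ae P, forall w, S w -> Z w = prediction_after P tau t u g (beta t w)}.
Proof.
move=> cZ.
have sV : sigma_of V `<=` Ft.
  apply: subset_trans sigma_of_V _.
  by apply: (sigma_of_beta P W tau t); rewrite lexx ltW.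
have := cond_exp_ae_on P Ft payoff Z V S (completed_algebra _ _ _ _)
  (completed_measurable P hP W hW tau t) cZ
  (completed_survival P W hW tau htau hind t) sV integral_V.
by apply: filterS2 prediction_V => w VE ZV Sw; rewrite ZV// VE.
Qed.

Let sigma_beta_algebra : sigma_algebra setT (sigma_of (beta t)).
Proof. by apply: sigma_algebra_preimage; exact: sigma_algebra_measurable. Qed.

Let sigma_beta_measurable : sigma_of (beta t) `<=` measurable.
Proof. exact: sigma_of_sub. Qed.

Let sigma_beta_past : sigma_of (beta t) `<=` Ft.
Proof. by apply: (sigma_of_beta P W tau t); rewrite lexx ltW. Qed.

(** The event [{t < tau}] need not belong to the sigma-algebra of [beta t], but
    [{beta t <> 0}] does, and the two agree almost surely. *)
Lemma cond_exp_present_survival Z : is_cond_exp P (sigma_of (beta t)) payoff Z ->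
  {ae P, forall w, S w -> Z w = prediction_after P tau t u g (beta t w)}.
Proof.
move=> cZ.
(* S' is the event of [beta t] that replaces [{t < tau}] *)
pose S' := beta t @^-1` (~` [set 0]).
have S'S : S' `<=` S.
  move=> w /= b0; rewrite ltNge; apply/negP => tw; apply: b0; exact: info_after.
have GS' : sigma_of (beta t) S' by apply: sigma_of_pre; exact: measurableC.
have eqS' A : sigma_of (beta t) A -> A `<=` S' ->
    (\int[P]_(w in A) (V w)%:E = \int[P]_(w in A) (payoff w)%:E)%E.
  by move=> /sigma_beta_past FA AS'; apply: integral_V => //; exact: subset_trans S'S.
have := cond_exp_ae_on P _ payoff Z V S' sigma_beta_algebra sigma_beta_measurable cZ GS' sigma_of_V eqS'.
have := survival_beta_neq0 P W hW tau hind t u t0 tu.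
apply: (filterS3 _ _ prediction_V) => w VE b0 ZV Sw.
by rewrite ZV ?VE//; exact: b0.
Qed.

(** On [{tau <= t}] the payoff is [g (tau, 0)], a function of the minimum of [tau] and
    [t], and therefore already known at time [t]. *)
Lemma cond_exp_past_default Z : is_cond_exp P Ft payoff Z ->
  {ae P, forall w, tau w <= t -> Z w = g (tau w, 0)}.
Proof.
move=> cZ; pose V2 w := g (Num.min (tau w) t, 0).
have sV2 : sigma_of V2 `<=` Ft.
  move=> _ [B mB <-]; rewrite setTI.
  apply: (completed_tau_min P W hW tau htau hind t).
  exists ((fun r => g (r, 0)) @^-1` B); last by rewrite setTI.
  have mg0 : measurable_fun setT (fun r : R => g (r, 0)).
    by apply: (measurableT_comp mg); exact: measurable_fun_pair.
  by rewrite -[X in measurable X]setTI; exact: (mg0 measurableT B mB).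
have FS : Ft [set w | tau w <= t] by exact: (completed_tau_le P W hW tau htau hind t).
have eqV2 A : Ft A -> A `<=` [set w | tau w <= t] ->
    (\int[P]_(w in A) (V2 w)%:E = \int[P]_(w in A) (payoff w)%:E)%E.
  move=> FA At; apply: eq_integral => w; rewrite inE => /At /= tw.
  by rewrite /V2 min_l// info_after// (le_trans tw)// ltW.
have := cond_exp_ae_on P Ft payoff Z V2 _ (completed_algebra _ _ _ _)
  (completed_measurable P hP W hW tau t) cZ FS sV2 eqV2.
by apply: filterS => w ZV tw; rewrite ZV// /V2 min_l.
Qed.

(** On [{beta t = 0}], which is [{tau <= t}] almost surely, the payoff is the
    constant [c]. *)
Lemma cond_exp_present_default Z c : is_cond_exp P (sigma_of (beta t)) payoff Z ->
  {ae P, forall w, tau w <= t -> g (tau w, 0) = c} ->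
  {ae P, forall w, tau w <= t -> Z w = g (tau w, 0)}.
Proof.
move=> cZ gc.
pose S0 := beta t @^-1` [set 0].
have GS0 : sigma_of (beta t) S0 by exact: sigma_of_pre.
have sc : sigma_of (cst c) `<=` sigma_of (beta t).
  exact: (sigma_of_cst _ _ c sigma_beta_algebra).
have eqc A : sigma_of (beta t) A -> A `<=` S0 ->
    (\int[P]_(w in A) (cst c w)%:E = \int[P]_(w in A) (payoff w)%:E)%E.
  move=> GA AS0; have mA := sigma_beta_measurable _ GA.
  apply: (ae_eq_integral (EFin \o payoff) (EFin \o cst c) mA).
  - by apply: measurable_funTS; apply/measurable_EFinP; exact: measurable_cst.
  - by apply: measurable_funTS; exact: (measurable_int P iX).
  have := survival_beta_neq0 P W hW tau hind t u t0 tu.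
  apply: filterS2 gc => w gc b0 Aw.
  have tw : tau w <= t by rewrite leNgt; apply/negP => /b0; apply; exact: AS0.
  by rewrite /= -(gc tw) info_after// (le_trans tw)// ltW.
have := cond_exp_ae_on P _ payoff Z (cst c) S0 sigma_beta_algebra sigma_beta_measurable cZ GS0 sc eqc.
apply: filterS2 gc => w gc ZV tw; rewrite ZV ?gc//.
exact: info_after.
Qed.

End identification.

(** * The prediction theorem *)

Section extension.
Context {d} {T : measurableType d} {R : realType}.

(** Extends [g] from positive times to a measurable function on the plane. *)
Definition ext0 (g : R * R -> R) (z : R * R) : R := if 0 < z.1 then g z else 0.

Lemma measurable_ext0 g : measurable_fun [set x : R * R | 0 < x.1] g ->
  measurable_fun setT (ext0 g).
Proof.
move=> mg; have mD : measurable [set x : R * R | 0 < x.1].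
  have mlt : measurable_fun setT (fun x : R * R => 0 < x.1) by exact: measurable_fun_ltr.
  by rewrite -[X in measurable X]setTI; exact: (mlt measurableT [set true]).
rewrite (_ : ext0 g = g \_ [set x : R * R | 0 < x.1]).
  exact/(measurable_restrictT _ mD).
by apply/funext => z; rewrite patchE /ext0; congr (if _ then _ else _); apply/idP/idP; rewrite inE.
Qed.

Lemma predictionE (P : probability T R) (tau : {RV P >-> R}) (W : R -> T -> R) g t u w :
  0 < t -> t < u -> t < tau w ->
  prediction tau (information_process W tau) g t u w =
  prediction_after P tau t u (ext0 g) (information_process W tau t w).
Proof.
move=> t0 tu tw; rewrite /prediction !indicE memNset/=; last first.
  by move=> /(lt_le_trans tw); rewrite ltxx.
rewrite mem_set//= mulr0 add0r !mulr1 /prediction_after; congr (_ + _).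
  apply: eq_Rintegral => r; rewrite inE/= in_itv/= => /andP[tr _].
  by rewrite /ext0/= (lt_trans t0 tr).
apply: eq_Rintegral => r; rewrite inE/= in_itv/= andbT => ur.
have r0 : 0 < r by apply: lt_trans ur; exact: lt_trans tu.
by congr (_ * _); apply: eq_Rintegral => y _; rewrite /ext0/= r0.
Qed.

Lemma prediction_default (P : probability T R) (tau : {RV P >-> R}) (W : R -> T -> R) g t u w :
  tau w <= t -> prediction tau (information_process W tau) g t u w = g (tau w, 0).
Proof.
move=> tw; rewrite /prediction !indicE mem_set//= mulr1.
by rewrite memNset/= ?mulr0 ?addr0// => /lt_geF; rewrite tw.
Qed.

End extension.

Theorem theorem5p1 (d : measure_display) (T : measurableType d) (R : realType)
    (P : probability T R) (hP : measure_is_complete P)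
    (W : R -> T -> R) (hW : standard_brownian_motion P W)
    (tau : {RV P >-> R}) (htau : forall w, 0 < tau w)
    (hind : indep P (sigma_of tau) (sigma_process `[0, +oo[ W))
    (hstop : ~ is_stopping_time (completed_filtration P W) tau)
    (t u : R) (ht : 0 < t) (htu : t < u)
    (g : R * R -> R) (hg : measurable_fun [set x : R * R | 0 < x.1] g) :
  let beta := information_process W tau in
  let X := fun w => g (tau w, beta u w) in
  let rhs := prediction tau beta g t u in
  ('E_P[fun w => `|X w|%R] < +oo)%E ->
  forall Z1 Z2 : T -> R,
    is_cond_exp P (completed_filtration P beta t) X Z1 ->
    is_cond_exp P (sigma_of (beta t)) X Z2 ->
  [/\ {ae P, forall w, Z1 w = rhs w},
      {ae P, forall w, t < tau w -> Z1 w = Z2 w /\ Z2 w = rhs w} &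
      (exists c, {ae P, forall w, tau w <= t -> g (tau w, 0) = c}) ->
        {ae P, forall w, Z1 w = Z2 w /\ Z2 w = rhs w}].
Proof.
move=> beta X rhs EX Z1 Z2 cZ1 cZ2.
pose g' := ext0 g.
have mg' : measurable_fun setT g' by exact: measurable_ext0.
have XE : X = (fun w => g' (tau w, beta u w)).
  by apply/funext => w; rewrite /X /g' /ext0/= htau.
have g'0 w : g' (tau w, 0) = g (tau w, 0) by rewrite /g' /ext0/= htau.
have mX : measurable_fun setT (fun w => g' (tau w, beta u w)).
  apply: measurableT_comp => //; apply: measurable_fun_pair => //.
  by apply: (measurable_info P W hW); exact: lt_trans htu.
have iX : P.-integrable setT (EFin \o (fun w => g' (tau w, beta u w))).
  apply/integrableP; split; first exact/measurable_EFinP.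
  by move: EX; rewrite unlock XE.
rewrite XE in cZ1 cZ2.
have rhs_after w : t < tau w -> rhs w = prediction_after P tau t u g' (beta t w).
  exact: predictionE.
have rhs_default w : tau w <= t -> rhs w = g (tau w, 0) by exact: prediction_default.
have Z1a := cond_exp_past_survival P hP W hW tau htau hind t u ht htu g' mg' iX Z1 cZ1.
have Z2a := cond_exp_present_survival P hP W hW tau htau hind t u ht htu g' mg' iX Z2 cZ2.
have Z1d := cond_exp_past_default P hP W hW tau htau hind t u ht htu g' mg' Z1 cZ1.
have Z1rhs : {ae P, forall w, Z1 w = rhs w}.
  apply: filterS2 Z1a Z1d => w a b; have [tw|tw] := ltP t (tau w).
    by rewrite a// rhs_after.
  by rewrite b// rhs_default.
have Z2rhs : {ae P, forall w, t < tau w -> Z2 w = rhs w}.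
  by apply: filterS Z2a => w a tw; rewrite a// rhs_after.
split => //.
- by apply: filterS2 Z1rhs Z2rhs => w e1 e2 tw; rewrite e1 e2.
- move=> [c gc].
  have gc' : {ae P, forall w, tau w <= t -> g' (tau w, 0) = c}.
    by apply: filterS gc => w e tw; rewrite g'0 e.
  have Z2d := cond_exp_present_default P W hW tau hind t u ht htu g' iX Z2 c cZ2 gc'.
  apply: filterS3 Z1rhs Z2rhs Z2d => w e1 e2 e3; rewrite e1.
  have [tw|tw] := ltP t (tau w); first by rewrite e2.
  by rewrite e3// rhs_default// g'0.
Qed.
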